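(* Let $G=\mathrm{SL}(3,\mathbb{Z})$ and let $H\le G$ be the copy of $\mathrm{SL}(2,\mathbb{Z})$ given by $H=\left\{\begin{pmatrix}1&0\\0&A\end{pmatrix} : A\in \mathrm{SL}(2,\mathbb{Z})\right\}$. Then the action of $G$ on the Stone-Čech boundary $\partial_\beta(G/H)$ of the discrete coset space $G/H$, induced by left translation of $G$ on $G/H$, is amenable.
   Context: For a discrete countable space $Z$, $\Delta_\beta Z$ denotes its Stone-Čech compactification, i.e. the set of ultrafilters on $Z$ with the topology generated by the sets $U_E=\{\omega : E\in\omega\}$, $E\subset Z$; the Stone-Čech boundary is $\partial_\beta Z=\Delta_\beta Z\setminus Z$, the compact set of free (non-principal) ultrafilters. An action of a group on $Z$ extends to an action by homeomorphisms on $\Delta_\beta Z$, preserving $\partial_\beta Z$. Let $\Gamma$ be a discrete countable group acting by homeomorphisms on a compact Hausdorff space $X$. Let $\mathcal{P}(\Gamma)$ be the set of probability measures on $\Gamma$ (viewed in $\ell^1(\Gamma)$), with the $\Gamma$-action $g\mu=\mu\circ g^{-1}$, i.e. $(g\mu)(A)=\mu(g^{-1}A)$. An approximate invariant continuous mean for the action is a net of continuous maps $\mu_\lambda:X\to\mathcal{P}(\Gamma)$ (with $\mathcal P(\Gamma)$ carrying the topology of pointwise convergence on $\Gamma$, equivalently the $\ell^1$-norm topology) such that $\lim_\lambda\sup_{x\in X}\|g\mu_\lambda(x)-\mu_\lambda(gx)\|_1=0$ for every $g\in\Gamma$. The action is amenable if it admits an approximate invariant continuous mean. *)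

(* Defs.v *)
From HB Require Import structures.
From mathcomp Require Import all_boot all_order all_algebra.
From mathcomp Require Import all_classical all_reals all_analysis.

Set Implicit Arguments.
Unset Strict Implicit.
Unset Printing Implicit Defensive.

Import Order.TTheory GRing.Theory Num.Theory.
Import numFieldNormedType.Exports.

Local Open Scope classical_set_scope.
Local Open Scope ring_scope.

Section SL.
Variable n : nat.

Record SL := MkSL { SL_mx :> 'M[int]_n; SL_det : \det SL_mx == 1 }.

HB.instance Definition _ := [isSub for SL_mx].
HB.instance Definition _ := [Countable of SL by <:].

Implicit Types A B : SL.

Fact SL_one_det : \det (1%:M : 'M[int]_n) == 1.
Proof. by rewrite det1. Qed.

Fact SL_mul_det A B : \det (A *m B) == 1.
Proof. by rewrite det_mulmx (eqP (SL_det A)) (eqP (SL_det B)) mulr1. Qed.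

Fact SL_unitmx A : (A : 'M[int]_n) \in unitmx.
Proof. by rewrite unitmxE (eqP (SL_det A)) unitr1. Qed.

Fact SL_inv_det A : \det (invmx A) == 1.
Proof. by rewrite det_inv (eqP (SL_det A)) invr1. Qed.

Definition SL_one := MkSL SL_one_det.
Definition SL_mul A B := MkSL (SL_mul_det A B).
Definition SL_inv A := MkSL (SL_inv_det A).

Fact SL_mulA : associative SL_mul.
Proof. by move=> A B C; apply: val_inj; rewrite /= mulmxA. Qed.
Fact SL_mul1 : left_id SL_one SL_mul.
Proof. by move=> A; apply: val_inj; rewrite /= mul1mx. Qed.
Fact SL_mulr1 : right_id SL_one SL_mul.
Proof. by move=> A; apply: val_inj; rewrite /= mulmx1. Qed.
Fact SL_mulV : left_inverse SL_one SL_inv SL_mul.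
Proof. by move=> A; apply: val_inj; rewrite /= mulVmx// SL_unitmx. Qed.
Fact SL_mulrV : right_inverse SL_one SL_inv SL_mul.
Proof. by move=> A; apply: val_inj; rewrite /= mulmxV// SL_unitmx. Qed.

HB.instance Definition _ :=
  isGroup.Build SL SL_mulA SL_mul1 SL_mulr1 SL_mulV SL_mulrV.

End SL.

Definition SL2_in_SL3 : set (SL 3) :=
  [set g | exists A : SL 2,
     SL_mx g = block_mx 1%:M 0 0 (SL_mx A) :> 'M[int]_(1 + 2)].

Lemma SL2_in_SL3_subgroup :
  [/\ SL2_in_SL3 1%g,
      forall g h, SL2_in_SL3 g -> SL2_in_SL3 h -> SL2_in_SL3 (g * h)%g &
      forall g, SL2_in_SL3 g -> SL2_in_SL3 (g^-1)%g].
Proof.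
have blockM (A B : 'M[int]_2) :
    block_mx 1%:M 0 0 A *m block_mx 1%:M 0 0 B =
    block_mx 1%:M 0 0 (A *m B) :> 'M[int]_(1 + 2).
  by rewrite mulmx_block !(mul0mx, mulmx0, mulmx1, addr0, add0r).
have block1 : block_mx 1%:M 0 0 1%:M = 1%:M :> 'M[int]_(1 + 2).
  by rewrite -scalar_mx_block.
split; first by exists 1%g; rewrite /= block1.
  move=> g h [A gA] [B hB]; exists (A * B)%g.
  by rewrite -[RHS]blockM -gA -hB.
move=> g [A gA]; exists (A^-1)%g; apply: (can_inj (mulKmx (SL_unitmx g))).
by rewrite mulmxV ?SL_unitmx// [X in X *m _]gA [RHS]blockM mulmxV ?SL_unitmx.
Qed.

Record setAction (G : groupType) (Z : Type) := MkSetAction {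
  act :> G -> Z -> Z;
  act1 : forall z, act 1%g z = z;
  actM : forall g h z, act (g * h)%g z = act g (act h z)
}.

(* Every [act g] is a homeomorphism, with continuous inverse [act g^-1]. *)
Record topAction (G : groupType) (X : topologicalType) := MkTopAction {
  top_act :> setAction G X;
  act_continuous : forall g, continuous (top_act g)
}.

Section cosets.
Variables (G : groupType) (H : set G).
Local Open Scope group_scope.

Definition left_cosets : set (set G) :=
  [set C | exists g : G, C = [set g * h | h in H]].

Fact left_translate_coset (g : G) (C : left_cosets) :
  [set g * x | x in \val C] \in left_cosets.
Proof.
have [k ->] := set_mem (valP C); apply/mem_set; exists (g * k).
by rewrite image_comp; apply: eq_imagel => h _ /=; rewrite mulgA.
Qed.

Definition left_translate (g : G) (C : left_cosets) : left_cosets :=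
  SigSub (left_translate_coset g C).

Fact left_translate1 C : left_translate 1 C = C.
Proof.
apply: val_inj => /=; rewrite -[RHS]image_id.
by apply: eq_imagel => x _; rewrite mul1g.
Qed.

Fact left_translateM g h C :
  left_translate (g * h) C = left_translate g (left_translate h C).
Proof.
apply: val_inj; rewrite /= image_comp.
by apply: eq_imagel => x _ /=; rewrite mulgA.
Qed.

Definition coset_action : setAction G left_cosets :=
  MkSetAction left_translate1 left_translateM.

End cosets.

Section stone_cech.

Record beta (Z : Type) := MkBeta {
  ultra :> set_system Z;
  ultraP : UltraFilter ultra
}.

#[global] Existing Instance ultraP.

HB.instance Definition _ (Z : Type) := gen_eqMixin (beta Z).
HB.instance Definition _ (Z : Type) := gen_choiceMixin (beta Z).

Lemma beta_inj Z (w1 w2 : beta Z) : ultra w1 = ultra w2 -> w1 = w2.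
Proof.
case: w1 w2 => [F FU] [F' FU'] /= E; move: FU'; rewrite -E => FU'.
by rewrite (Prop_irrelevance FU FU').
Qed.

Definition beta_basic Z (E : set Z) : set (beta Z) := [set w | ultra w E].

Fact beta_basic_cover Z : \bigcup_(E in [set: set Z]) beta_basic E = [set: beta Z].
Proof.
by apply/seteqP; split => // w _; exists setT => //; exact: filterT.
Qed.

Fact beta_basic_join Z (E F : set Z) (w : beta Z) :
  [set: set Z] E -> [set: set Z] F -> beta_basic E w -> beta_basic F w ->
  exists K, [/\ [set: set Z] K, beta_basic K w &
                beta_basic K `<=` beta_basic E `&` beta_basic F].
Proof.
move=> _ _ wE wF; exists (E `&` F); split => //.
  exact: filterI.
by move=> v vEF; split; apply: filterS vEF => z [].
Qed.

HB.instance Definition _ (Z : Type) := @isBaseTopological.Build (beta Z)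
  (set Z) setT (@beta_basic Z) (@beta_basic_cover Z) (@beta_basic_join Z).

Lemma fmap_ultra (T U : Type) (f : T -> U) (F : set_system T) :
  UltraFilter F -> UltraFilter (f @ F).
Proof.
move=> FU; split; first exact: fmap_proper_filter.
move=> H HF sH; apply/seteqP; split => // E HE.
have [//|FEc] := in_ultra_setVsetC (f @^-1` E) FU.
have /sH HEc : (f @ F) (~` E) by [].
by case: (filter_not_empty H); rewrite -(setICr E); exact: filterI.
Qed.

Definition beta_point Z (z : Z) : beta Z := MkBeta (principal_filter_ultra z).

Definition beta_boundary (Z : Type) : set (beta Z) := ~` range (@beta_point Z).

Lemma beta_basic_open Z (E : set Z) : open (beta_basic E).
Proof.
exists [set E] => //; apply/seteqP; split => [w [_ -> //]|w wE].
by exists E.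
Qed.

Lemma beta_nbhs Z (w : beta Z) (U : set (beta Z)) :
  nbhs w U <-> exists2 E, ultra w E & beta_basic E `<=` U.
Proof.
split=> [|[E wE sEU]]; last first.
  by apply: (filterS sEU); apply: open_nbhs_nbhs; split=> //; exact: beta_basic_open.
rewrite nbhsE => -[_ [[D _ <-] [E DE wE]] sU]; exists E => //.
by apply: subset_trans sU => v vE; exists E.
Qed.

Lemma beta_notC Z (w : beta Z) (E : set Z) : ultra w E -> ~ ultra w (~` E).
Proof.
move=> wE wEc; apply: (filter_not_empty (ultra w)).
by rewrite -(setICr E); exact: filterI.
Qed.

Lemma beta_hausdorff Z : hausdorff_space (beta Z).
Proof.
rewrite open_hausdorff => w v /eqP wv.
have [E [wE vE]] : exists E, ultra w E /\ ~ ultra v E.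
  apply: contrapT => noE; apply: wv; apply: beta_inj; apply/esym.
  apply: (@max_filter _ _ (ultraP w)).
  by move=> E wE; apply: contrapT => vE; apply: noE; exists E.
exists (beta_basic E, beta_basic (~` E)); split => /=.
- exact/mem_set.
- by apply/mem_set; case: (in_ultra_setVsetC E (ultraP v)).
- exact: beta_basic_open.
- exact: beta_basic_open.
- apply/eqP; rewrite -subset0 => u [uE uEc]; exact: beta_notC uE uEc.
Qed.

Lemma beta_compact Z : compact [set: beta Z].
Proof.
rewrite compact_ultra => F FU _.
pose W : set_system Z := [set E | F (beta_basic E)].
have WU : UltraFilter W.
  split; first split.
  - rewrite /W /= (_ : beta_basic _ = set0); first exact: (filter_not_empty F).
    by rewrite -subset0 => v; exact: (filter_not_empty (ultra v)).
  - split.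
    + by apply: (@filterS _ F _ setT) (@filterT _ F _) => v _; exact: (@filterT _ (ultra v)).
    + move=> E E' WE WE'; apply: (@filterS _ F) (@filterI _ F _ _ _ WE WE').
      by move=> v [vE vE']; exact: (@filterI _ (ultra v)).
    + move=> E E' sEE'; apply: (@filterS _ F) => v.
      exact: (@filterS _ (ultra v)).
  - move=> H HF sWH; apply/seteqP; split => // E HE.
    have [//|FEc] := in_ultra_setVsetC (beta_basic E) FU.
    have : W (~` E).
      apply: (@filterS _ F) FEc => v nvE.
      by case: (in_ultra_setVsetC E (ultraP v)).
    move=> /sWH HEc.
    by case: (filter_not_empty H); rewrite -(setICr E); exact: filterI.
exists (MkBeta WU); split => // U /beta_nbhs[E WE sEU].
exact: filterS sEU WE.
Qed.

Lemma beta_boundary_closed Z : closed (@beta_boundary Z).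
Proof.
apply: open_closedC; rewrite openE => _ [z _ <-]; apply/beta_nbhs.
exists [set z]; first exact/principal_filterP.
move=> w wz; exists z => //; apply: beta_inj; apply/esym.
apply: (@max_filter _ _ (principal_filter_ultra z)).
move=> E /principal_filterP Ez.
by apply: filterS wz => _ ->.
Qed.

Lemma beta_boundary_compact Z : compact [set: @beta_boundary Z].
Proof.
rewrite compact_ultra => F FU _.
have cptB : compact (@beta_boundary Z).
  by apply: (subclosed_compact _ (@beta_compact Z)) => //; exact: beta_boundary_closed.
rewrite compact_ultra in cptB.
have [|p [bp Fp]] := cptB (val @ F) (fmap_ultra _ FU).
  by apply: (@filterS _ F _ setT) (@filterT _ F _) => w _; exact: set_mem (valP w).
exists (SigSub (mem_set bp)); split => // U [_ [[V oV <-] /= Vp sVU]].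
apply: (@filterS _ F) sVU _; apply: Fp; exact: open_nbhs_nbhs.
Qed.

Lemma beta_boundary_hausdorff Z : hausdorff_space (@beta_boundary Z).
Proof.
move=> p q pq; apply: val_inj; apply: (@beta_hausdorff Z) => U V Up Vq.
have cval := @initial_continuous (@beta_boundary Z) (beta Z) set_val.
by have [w [Uw Vw]] := pq _ _ (cval p U Up) (cval q V Vq); exists (val w).
Qed.

(* The continuous extension of [f]: [E] is in [beta_map f w] iff [f @^-1` E] is
   in [w]. *)
Definition beta_map Z W (f : Z -> W) (w : beta Z) : beta W :=
  MkBeta (fmap_ultra f (ultraP w)).

Lemma beta_map_continuous Z W (f : Z -> W) : continuous (beta_map f).
Proof.
move=> w U /beta_nbhs[E wE sEU]; apply/beta_nbhs; exists (f @^-1` E) => //.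
by move=> v vE; apply: sEU.
Qed.

Lemma beta_map_point Z W (f : Z -> W) (z : Z) :
  beta_map f (beta_point z) = beta_point (f z).
Proof.
apply: beta_inj; apply/seteqP.
by split=> E /= /principal_filterP Ez; apply/principal_filterP.
Qed.

End stone_cech.

Section beta_action.
Variables (G : groupType) (Z : Type) (a : setAction G Z).

Fact beta_act1 w : beta_map (a 1%g) w = w.
Proof.
apply: beta_inj; rewrite /= (_ : a 1%g = id) //.
by apply/funext => z; rewrite act1.
Qed.

Fact beta_actM g h w : beta_map (a (g * h)%g) w = beta_map (a g) (beta_map (a h) w).
Proof.
apply: beta_inj; rewrite /= (_ : a (g * h)%g = a g \o a h) //.
by apply/funext => z; rewrite actM.
Qed.

Definition beta_action : topAction G (beta Z) :=
  @MkTopAction G (beta Z) (MkSetAction beta_act1 beta_actM)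
    (fun g => @beta_map_continuous Z Z (a g)).

Fact boundary_act_subproof g (w : @beta_boundary Z) :
  beta_action g (\val w) \in @beta_boundary Z.
Proof.
apply/mem_set => -[z _ E]; have := set_mem (valP w); apply.
exists (a g^-1%g z) => //; rewrite -beta_map_point E.
by rewrite /= -beta_actM mulVg beta_act1.
Qed.

Definition boundary_act g (w : @beta_boundary Z) : @beta_boundary Z :=
  SigSub (boundary_act_subproof g w).

Fact boundary_act1 w : boundary_act 1%g w = w.
Proof. by apply: val_inj; exact: beta_act1. Qed.

Fact boundary_actM g h w :
  boundary_act (g * h)%g w = boundary_act g (boundary_act h w).
Proof. by apply: val_inj; exact: beta_actM. Qed.

Fact boundary_act_continuous g : continuous (boundary_act g).
Proof.
apply/continuousP => _ [V oV <-].
exists (beta_map (a g) @^-1` V) => //.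
by move/continuousP: (@beta_map_continuous _ _ (a g)); exact.
Qed.

Definition boundary_action : topAction G (@beta_boundary Z) :=
  @MkTopAction G (@beta_boundary Z) (MkSetAction boundary_act1 boundary_actM)
    boundary_act_continuous.

End beta_action.

Section amenable.
Variables (R : realType) (G : groupType).

(* A probability measure on the discrete group [G], given by its density with
   respect to the counting measure. *)
Record prob := MkProb {
  density :> G -> R;
  density_ge0 : forall h, 0 <= density h;
  density_sum : (\esum_(h in [set: G]) (density h)%:E = 1)%E
}.

HB.instance Definition _ := gen_eqMixin prob.
HB.instance Definition _ := gen_choiceMixin prob.

HB.instance Definition _ := Topological.copy prob
  (initial_topology (density : prob -> {ptws G -> R})).

Definition translate (g : G) (m : G -> R) : G -> R := fun h => m (g^-1 * h)%g.

Definition l1norm (f : G -> R) : \bar R := \esum_(h in [set: G]) `|f h|%:E.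

(* The supremum is taken in [0, +oo], so that it is 0 when [X] is empty. *)
Definition equivariance_defect (X : topologicalType) (a : topAction G X)
    (mu : X -> prob) (g : G) : \bar R :=
  ereal_sup ([set 0%:E] `|` range (fun x : X =>
    l1norm (fun h => translate g (mu x) h - mu (a g x) h))).

Definition directed d (L : preorderType d) :=
  [set: L] !=set0 /\ forall k l : L, exists m : L, (k <= m)%O /\ (l <= m)%O.

(* The filter of eventual sets of a net indexed by [L]. *)
Definition tails d (L : preorderType d) : set_system L :=
  filter_from setT (fun k : L => [set l | (k <= l)%O]).

Arguments tails {d} L.

Lemma tails_proper_filter d (L : preorderType d) :
  directed L -> ProperFilter (tails L).
Proof.
move=> [[l0 _] dirL]; apply: filter_from_proper; last by move=> k _; exists k => /=.
apply: filter_from_filter; first by exists l0.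
move=> k l _ _; have [m [km lm]] := dirL k l; exists m => // n /= mn.
by split; [exact: le_trans km mn|exact: le_trans lm mn].
Qed.

Definition approx_invariant_mean (X : topologicalType) (a : topAction G X)
    d (L : preorderType d) (mu : L -> X -> prob) :=
  [/\ directed L, forall l, continuous (mu l) &
      forall g, equivariance_defect a (mu l) g @[l --> tails L] --> 0%E].

Definition amenable (X : topologicalType) (a : topAction G X) :=
  exists (d : Order.disp_t) (L : preorderType d) (mu : L -> X -> prob),
    approx_invariant_mean a mu.

End amenable.

(* Main.v *)
(** A coset [g H] is determined by the first column [v] of [g] and the first row
    [p] of [g^-1], integer vectors with [p v = 1]. Along a free ultrafilter
    [|v| |p|] tends to infinity, so the limits of [v / |v|] and [p / |p|] are
    orthogonal and define a full flag of R^3, hence a continuous map from the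
    boundary to flags which is equivariant under SL(3, Z).

    The action on flags is amenable because its stabilizers are solvable, which is
    made explicit as follows. For an orthonormal frame [k] adapted to the flag and
    positive weights [w], give [h] in SL(3, Z) the mass
    [(1 + \sum_ij w_j ((h^-1 k)_ij)^2)^-9] and normalize. If [g k = k' q] with [q]
    upper triangular and [w_1 >> w_2 >> w_3], translating by [g] amounts up to a
    small l1 error to replacing [k] by [k'] and [w_j] by [w_j q_jj^2]: far inside
    the Weyl chamber the unipotent part of [q] is contracted away. Averaging the
    weights [((1 + e)^a, (1 + e)^b, (1 + e)^c)] over a large box of exponents,
    far out in that chamber, absorbs the remaining bounded shift. *)

Require Import Defs.
From mathcomp Require Import all_boot all_order all_algebra.
From mathcomp Require Import all_classical all_reals all_analysis.
From mathcomp Require Import ring lra zify.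

Set Implicit Arguments.
Unset Strict Implicit.
Unset Printing Implicit Defensive.

Import Order.TTheory GRing.Theory Num.Theory.
Import numFieldNormedType.Exports.

Local Open Scope classical_set_scope.
Local Open Scope ring_scope.

(** * Finite l1 estimates and probability densities *)

Section l1_bounds.
Variables (R : realType) (T : choiceType).
Implicit Types (f g h : T -> R) (a b c : R).

Lemma esum_le_seq f c : (forall s : seq T, uniq s -> \sum_(x <- s) f x <= c) ->
  (\esum_(x in [set: T]) (f x)%:E <= c%:E)%E.
Proof.
move=> fc; apply: ge_ereal_sup => _ [X [finX _] <-].
by rewrite fsbig_finite//= sumEFin lee_fin fc// finmap.fset_uniq.
Qed.

Lemma seq_le_esum f (s : seq T) : uniq s ->
  ((\sum_(x <- s) f x)%:E <= \esum_(x in [set: T]) (f x)%:E)%E.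
Proof.
move=> us; apply: esum_ge; exists [set` s]; first by split.
by rewrite -fsbig_seq// sumEFin.
Qed.

Lemma esumZl (r : R) (f : T -> R) : 0 < r ->
  (\esum_(x in [set: T]) (r * f x)%:E =
   r%:E * \esum_(x in [set: T]) (f x)%:E)%E.
Proof.
have le_scale (q : R) h : 0 < q -> (\esum_(x in [set: T]) (q * h x)%:E <=
    q%:E * \esum_(x in [set: T]) (h x)%:E)%E.
  move=> q0; apply: ge_ereal_sup => _ [X [finX _] <-].
  rewrite fsbig_finite//= sumEFin -mulr_sumr EFinM lee_pmul2l ?lte_fin//.
  by apply: seq_le_esum; rewrite finmap.fset_uniq.
move=> r0; apply/eqP; rewrite eq_le le_scale//=.
rewrite -[leRHS]mul1e -(divff (lt0r_neq0 r0)) EFinM -muleA lee_pmul2l ?lte_fin//.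
have := le_scale r^-1 (fun x => r * f x); rewrite invr_gt0 => /(_ r0).
by under eq_esum do rewrite mulKf ?gt_eqF//.
Qed.

(** Bounding the sums over duplicate-free lists says that the l1 norm is at most [c], without
    infinite sums or summability conditions. *)
Definition l1_le f c := forall s : seq T, uniq s -> \sum_(x <- s) `|f x| <= c.

Lemma l1_le_ge f x c : l1_le f c -> `|f x| <= c.
Proof. by move=> /(_ [:: x] isT); rewrite big_seq1. Qed.

Lemma eq_l1_le f g c : f =1 g -> l1_le f c -> l1_le g c.
Proof. by move=> /funext ->. Qed.

Lemma l1_leW f a b : a <= b -> l1_le f a -> l1_le f b.
Proof. by move=> ab fa s /fa/le_trans; exact. Qed.

Lemma l1_leN f c : l1_le f c -> l1_le (fun x => - f x) c.
Proof. by move=> fc s us; under eq_bigr do rewrite normrN; exact: fc. Qed.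

Lemma l1_leD f g a b :
  l1_le f a -> l1_le g b -> l1_le (fun x => f x + g x) (a + b).
Proof.
move=> fa gb s us; apply: le_trans (lerD (fa s us) (gb s us)).
by rewrite -big_split ler_sum// => x _; exact: ler_normD.
Qed.

Lemma l1_le_trans f g h a b : l1_le (fun x => f x - g x) a ->
  l1_le (fun x => g x - h x) b -> l1_le (fun x => f x - h x) (a + b).
Proof.
by move=> fg gh; apply: eq_l1_le (l1_leD fg gh) => x; rewrite addrA subrK.
Qed.

Lemma l1_leZ f c a : 0 <= a -> l1_le f c -> l1_le (fun x => a * f x) (a * c).
Proof.
move=> a0 fc s us; under eq_bigr do rewrite normrM ger0_norm//.
by rewrite -mulr_sumr ler_wpM2l// fc.
Qed.

Lemma l1_le_sum n (F : 'I_n -> T -> R) c : (forall i, l1_le (F i) c) ->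
  l1_le (fun x => \sum_i F i x) (n%:R * c).
Proof.
move=> Fc s us; apply: (@le_trans _ _ (\sum_(x <- s) \sum_i `|F i x|)).
  by apply: ler_sum => x _; exact: ler_norm_sum.
rewrite exchange_big -[X in X%:R]card_ord -sum1_card natr_sum mulr_suml.
by apply: ler_sum => i _; rewrite mul1r; exact: Fc.
Qed.

Lemma l1_le_sumB n (F F' : 'I_n -> T -> R) c :
  (forall i, l1_le (fun x => F i x - F' i x) c) ->
  l1_le (fun x => \sum_i F i x - \sum_i F' i x) (n%:R * c).
Proof. by move=> /l1_le_sum; apply: eq_l1_le => x; rewrite sumrB. Qed.

(** A shift by one changes only the two end terms of the sum, so the cost does not depend on [L]:
    long intervals are Foelner sets. *)
Lemma l1_le_shift (F : nat -> T -> R) c L m : (forall n, l1_le (F n) c) ->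
  l1_le (fun x => \sum_(i < L) F (i + m)%N x - \sum_(i < L) F i x) (m%:R * (c + c)).
Proof.
move=> Fc; elim: m => [|m IHm].
  move=> s us; rewrite mul0r big1// => x _.
  by under eq_bigr do rewrite addn0; rewrite subrr normr0.
rewrite -natr1 mulrDl mul1r addrC; apply: l1_le_trans IHm.
apply: eq_l1_le (l1_leD (Fc (L + m)%N) (l1_leN (Fc m))) => x.
have : \sum_(i < L.+1) F (i + m)%N x = \sum_(i < L.+1) F (i + m)%N x by [].
rewrite [LHS]big_ord_recr [RHS]big_ord_recl /= add0n => /eqP.
rewrite -subr_eq0 => /eqP E; under [X in _ = X - _]eq_bigr do rewrite addnS -addSn.
have {}E : \sum_(i < L) F (i + m)%N x + F (L + m)%N x -
  (F m x + \sum_(i < L) F (i.+1 + m)%N x) = 0 by [].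
lra.
Qed.

Definition box_sum L (F : nat -> nat -> nat -> T -> R) (x : T) : R :=
  \sum_(i < L) \sum_(j < L) \sum_(k < L) F i j k x.

(** The coordinates are shifted one at a time, each at a cost proportional to the face area [L * L],
    which is small against the volume [L ^ 3]. *)
Lemma l1_le_box_shift (F : nat -> nat -> nat -> T -> R) c L m1 m2 m3 :
  (forall i j k, l1_le (F i j k) c) ->
  l1_le (fun x => box_sum L (fun i j k => F (i + m1)%N (j + m2)%N (k + m3)%N) x -
    box_sum L F x) ((m1 + m2 + m3)%:R * (c + c) * (L%:R * L%:R)).
Proof.
move=> Fc; rewrite !natrD !mulrDl.
have c0 : 0 <= c by apply: le_trans (Fc 0%N 0%N 0%N nil isT); rewrite big_nil.
apply: (@l1_le_trans _ (box_sum L (fun i j k => F i j (k + m3)%N))).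
  apply: (@l1_le_trans _ (box_sum L (fun i j k => F i (j + m2)%N (k + m3)%N))).
    apply: (@l1_leW _ (m1%:R * (L%:R * (L%:R * c) + L%:R * (L%:R * c)))).
      by rewrite le_eqVlt; apply/orP; left; apply/eqP; ring.
    apply: (l1_le_shift L m1 (F := fun i x =>
      \sum_(j < L) \sum_(k < L) F i (j + m2)%N (k + m3)%N x)) => i.
    apply: l1_le_sum => j.
    by apply: l1_le_sum => k; exact: Fc.
  apply: (@l1_leW _ (L%:R * (m2%:R * (L%:R * c + L%:R * c)))).
    by rewrite le_eqVlt; apply/orP; left; apply/eqP; ring.
  apply: l1_le_sumB => i.
  apply: (l1_le_shift L m2 (F := fun j x => \sum_(k < L) F i j (k + m3)%N x)) => j.
  by apply: l1_le_sum => k; exact: Fc.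
apply: (@l1_leW _ (L%:R * (L%:R * (m3%:R * (c + c))))).
  by rewrite le_eqVlt; apply/orP; left; apply/eqP; ring.
apply: l1_le_sumB => i; apply: l1_le_sumB => j.
by apply: (l1_le_shift L m3 (F := fun k x => F i j k x)) => k; exact: Fc.
Qed.

End l1_bounds.

(** * Positive summable functions on a group and their normalization *)

Section normalization.
Variables (R : realType) (G : groupType).
Implicit Types (W : G -> R) (g : G).

Lemma prob_l1_le (p : prob R G) : l1_le p 1.
Proof.
move=> s us; under eq_bigr do rewrite ger0_norm ?density_ge0//.
by rewrite -lee_fin -(density_sum p) seq_le_esum.
Qed.

Definition positive_summable W := (forall x, 0 < W x) /\ exists c, l1_le W c.

Definition mass W : R := fine (\esum_(x in [set: G]) (W x)%:E)%E.

Lemma massE W : positive_summable W ->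
  ((mass W)%:E = \esum_(x in [set: G]) (W x)%:E)%E.
Proof.
move=> [W0 [c Wc]]; rewrite /mass fineK// ge0_fin_numE; last first.
  by apply: esum_ge0 => x _; rewrite lee_fin ltW.
apply: le_lt_trans (ltry c); apply: esum_le_seq => s us.
by apply: le_trans (Wc s us); apply: ler_sum => x _; exact: ler_norm.
Qed.

Lemma sum_le_mass W (s : seq G) : positive_summable W -> uniq s ->
  \sum_(x <- s) W x <= mass W.
Proof. by move=> Wps us; rewrite -lee_fin massE// seq_le_esum. Qed.

Lemma mass_le W c : positive_summable W ->
  (forall s : seq G, uniq s -> \sum_(x <- s) W x <= c) -> mass W <= c.
Proof. by move=> Wps Wc; rewrite -lee_fin massE// esum_le_seq. Qed.

Lemma mass_gt0 W : positive_summable W -> 0 < mass W.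
Proof.
move=> Wps; apply: lt_le_trans (sum_le_mass (s := [:: 1%g]) Wps isT).
by rewrite big_seq1 Wps.1.
Qed.

Lemma translate_positive_summable g W :
  positive_summable W -> positive_summable (translate g W).
Proof.
move=> [W0 [c Wc]]; split => [x|]; first exact: W0.
exists c => s us; rewrite -(big_map (fun x => g^-1 * x)%g xpredT (fun x => `|W x|)).
by apply: Wc; rewrite map_inj_uniq//; exact: mulgI.
Qed.

Lemma mass_translate g W : positive_summable W -> mass (translate g W) = mass W.
Proof.
move=> Wps; apply/eqP; rewrite eq_le; apply/andP; split; apply: mass_le => //.
- exact: translate_positive_summable.
- move=> s us; rewrite -(big_map (fun x => g^-1 * x)%g xpredT W).
  by apply: sum_le_mass; rewrite // map_inj_uniq//; exact: mulgI.
- move=> s us; have -> : \sum_(x <- s) W x =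
      \sum_(x <- map (fun x => g * x)%g s) translate g W x.
    by rewrite big_map; apply: eq_bigr => x _; rewrite /translate mulKg.
  apply: sum_le_mass; first exact: translate_positive_summable.
  by rewrite map_inj_uniq//; exact: mulgI.
Qed.

Lemma normalized_sum W : positive_summable W ->
  (\esum_(x in [set: G]) ((mass W)^-1 * W x)%:E = 1)%E.
Proof.
move=> Wps; rewrite esumZl ?invr_gt0 ?mass_gt0// -massE// -EFinM.
by rewrite mulVf// gt_eqF ?mass_gt0.
Qed.

Lemma normalized_ge0 W : positive_summable W -> forall x, 0 <= (mass W)^-1 * W x.
Proof. by move=> Wps x; rewrite mulr_ge0// ltW ?invr_gt0 ?mass_gt0 ?Wps.1. Qed.

Definition normalized W (Wps : positive_summable W) : prob R G :=
  MkProb (normalized_ge0 Wps) (normalized_sum Wps).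

Lemma mass_le_scale W W' k : positive_summable W -> positive_summable W' ->
  0 <= k -> (forall x, W x <= k * W' x) -> mass W <= k * mass W'.
Proof.
move=> Wps W'ps k0 WW'; apply: mass_le => // s us.
apply: le_trans (_ : k * \sum_(x <- s) W' x <= _).
  by rewrite mulr_sumr; apply: ler_sum.
by rewrite ler_wpM2l// sum_le_mass.
Qed.

(** Comparability up to [k] passes to the masses, so the normalized densities are comparable up to
    [k ^+ 2]. *)
Lemma normalized_le_scale W W' k : positive_summable W -> positive_summable W' ->
  1 <= k -> (forall x, W x <= k * W' x) -> (forall x, W' x <= k * W x) ->
  forall x, (mass W)^-1 * W x - (mass W')^-1 * W' x <=
    (k ^+ 2 - 1) * ((mass W')^-1 * W' x).
Proof.
move=> Wps W'ps k1 WW' W'W x; have k0 : 0 < k by apply: lt_le_trans k1.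
have m0 := mass_gt0 Wps; have m'0 := mass_gt0 W'ps.
have mm : mass W' <= k * mass W by apply: mass_le_scale => //; exact: ltW.
have mi : (mass W)^-1 <= k * (mass W')^-1.
  by rewrite ler_pdivlMr// mulrC ler_pdivrMr.
rewrite mulrBl mul1r lerB//.
apply: le_trans (ler_pM _ _ mi (WW' x)) _.
- by rewrite invr_ge0 ltW.
- by rewrite ltW ?Wps.1.
- by rewrite le_eqVlt; apply/orP; left; apply/eqP; ring.
Qed.

Lemma normalized_dist W W' k : positive_summable W -> positive_summable W' ->
  1 <= k -> (forall x, W x <= k * W' x) -> (forall x, W' x <= k * W x) ->
  l1_le (fun x => (mass W)^-1 * W x - (mass W')^-1 * W' x) (2 * (k ^+ 2 - 1)).
Proof.
move=> Wps W'ps k1 WW' W'W s us.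
have k2 : 0 <= k ^+ 2 - 1 by rewrite subr_ge0 exprn_ege1.
pose p x := (mass W)^-1 * W x; pose p' x := (mass W')^-1 * W' x.
have p0 x : 0 <= p x by exact: normalized_ge0.
have p'0 x : 0 <= p' x by exact: normalized_ge0.
apply: (@le_trans _ _ (\sum_(x <- s) ((k ^+ 2 - 1) * p x + (k ^+ 2 - 1) * p' x))).
  apply: ler_sum => x _; rewrite ler_norml; apply/andP; split.
    rewrite lerNl opprB; apply: le_trans (normalized_le_scale _ _ k1 _ _ x) _ => //.
    by rewrite lerDl mulr_ge0.
  apply: le_trans (normalized_le_scale _ _ k1 _ _ x) _ => //.
  by rewrite lerDr mulr_ge0.
have le1 V : positive_summable V -> \sum_(x <- s) (mass V)^-1 * V x <= 1.
  move=> Vps; rewrite -mulr_sumr ler_pdivrMl ?mass_gt0// mulr1.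
  exact: sum_le_mass.
rewrite big_split /= -[X in X + _]mulr_sumr -[X in _ + X]mulr_sumr -mulrDr mulrC.
by rewrite ler_wpM2r// -[leRHS]/(1 + 1); apply: lerD; exact: le1.
Qed.

Section box_average.
Variables (L : nat) (F : nat -> nat -> nat -> prob R G) (L0 : (0 < L)%N).

Let box_average_ge0 x : 0 <= (L%:R ^+ 3)^-1 * box_sum L F x.
Proof.
rewrite mulr_ge0 ?invr_ge0 ?exprn_ge0//.
do 3!(apply: sumr_ge0 => ? _); exact: density_ge0.
Qed.

Let box_average_sum :
  (\esum_(x in [set: G]) ((L%:R ^+ 3)^-1 * box_sum L F x)%:E = 1)%E.
Proof.
have L3 : 0 < (L%:R : R) ^+ 3 by rewrite exprn_gt0// ltr0n.
rewrite esumZl ?invr_gt0//.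
have sumE (H : 'I_L -> G -> R) c : (forall i x, 0 <= H i x) ->
    (forall i, \esum_(x in [set: G]) (H i x)%:E = c%:E)%E ->
    (\esum_(x in [set: G]) (\sum_i H i x)%:E = (L%:R * c)%:E)%E.
  move=> H0 Hc; under eq_esum do rewrite -sumEFin.
  rewrite esum_sum; last by move=> x i _ _; rewrite lee_fin.
  by under eq_bigr do rewrite Hc; rewrite sumEFin sumr_const card_ord mulr_natl.
rewrite (sumE _ (L%:R * (L%:R * 1))).
- by rewrite -EFinM mulr1 exprS expr2 mulVf// gt_eqF// -expr2 -exprS.
- by move=> i x; do 2!(apply: sumr_ge0 => ? _); exact: density_ge0.
- move=> i; apply: (sumE) => [j x|j]; first by apply: sumr_ge0 => ? _; exact: density_ge0.
  by apply: (sumE) => [k x|k]; [exact: density_ge0|exact: density_sum].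
Qed.

Definition box_average : prob R G := MkProb box_average_ge0 box_average_sum.

End box_average.

End normalization.

(** * Quadratic forms in a frame *)

Section real_estimates.
Variable R : realType.
Implicit Types (x y t e : R).

(** Young's inequality with a parameter: expand the nonnegative [t^-1 * (t * x - y) ^+ 2]. *)
Lemma sqrD_le t x y : 0 < t ->
  (x + y) ^+ 2 <= (1 + t) * x ^+ 2 + (1 + t^-1) * y ^+ 2.
Proof.
move=> t0; have tV : t * t^-1 = 1 by rewrite divff ?gt_eqF.
have s0 : 0 < t^-1 by rewrite invr_gt0.
have : 0 <= t^-1 * (t * x - y) ^+ 2 by rewrite mulr_ge0 ?sqr_ge0// ltW.
have -> : t^-1 * (t * x - y) ^+ 2 = (t * t^-1) * t * x ^+ 2
  - 2 * (t * t^-1) * (x * y) + t^-1 * y ^+ 2 by ring.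
rewrite tV => h; nra.
Qed.

(* [N] is the value at [y] of the form [\sum_j w_j (y q)_j ^ 2] for [q] upper
   triangular, and [D] keeps only the diagonal of [q]: each off-diagonal term
   enters with a much smaller weight than that of a diagonal term bounding it. *)
Lemma triangular_form_close e K : 0 < e -> e <= 1 -> 1 <= K ->
  exists2 M : R, 1 <= M & forall w1 w2 w3 q11 q22 q33 q12 q13 q23 y1 y2 y3 : R,
    0 < w3 -> M * w3 <= w2 -> M * w2 <= w1 ->
    1 <= K * q11 ^+ 2 -> 1 <= K * q22 ^+ 2 ->
    q12 ^+ 2 <= K -> q13 ^+ 2 <= K -> q23 ^+ 2 <= K ->
    let D := w1 * (q11 * y1) ^+ 2 + w2 * (q22 * y2) ^+ 2 + w3 * (q33 * y3) ^+ 2 in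
    let N := w1 * (q11 * y1) ^+ 2 + w2 * (q12 * y1 + q22 * y2) ^+ 2 +
      w3 * (q13 * y1 + q23 * y2 + q33 * y3) ^+ 2 in
    N <= (1 + e) * D /\ D <= (1 + e) * N.
Proof.
move=> e0 e1 K1; have [t t0 et] : exists2 t : R, 0 < t & e = 4 * t.
  by exists (e / 4); [rewrite divr_gt0|field].
have tV0 : 0 < t^-1 by rewrite invr_gt0.
have K0 : 0 < K by exact: lt_le_trans K1.
pose P : R := (1 + t^-1) * (K * K).
have P0 : 0 < P by rewrite !mulr_gt0 ?addr_gt0.
(* With this [M], [t * (M * w) = t * w + 3 * P * w]. Hence [t * w1] absorbs the cross terms [P * w2]
   and [2 * P * w3] falling on [X1], and [t * w2] absorbs [2 * P * w3] falling on [X2]. *)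
exists (1 + 3 * P / t) => [|w1 w2 w3 q11 q22 q33 q12 q13 q23 y1 y2 y3].
  by rewrite lerDl; apply/ltW/divr_gt0 => //; apply: mulr_gt0.
move=> w30 w23 w12 q11K q22K q12K q13K q23K D N.
have Mt (w : R) : t * ((1 + 3 * P / t) * w) = t * w + 3 * P * w.
  by field; rewrite gt_eqF.
have tw2 : 3 * P * w3 + t * w3 <= t * w2.
  by rewrite addrC -Mt ler_pM2l.
have tw1 : 3 * P * w2 + t * w2 <= t * w1.
  by rewrite addrC -Mt ler_pM2l.
have Pw3 : 0 < P * w3 by exact: mulr_gt0.
have w32 : w3 <= w2 by rewrite -(ler_pM2l t0); lra.
have w20 : 0 < w2 by exact: lt_le_trans w32.
have w21 : w2 <= w1.
  have Pw2 : 0 < P * w2 by exact: mulr_gt0.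
  by rewrite -(ler_pM2l t0); lra.
pose X1 := (q11 * y1) ^+ 2; pose X2 := (q22 * y2) ^+ 2; pose X3 := (q33 * y3) ^+ 2.
have X10 : 0 <= X1 by exact: sqr_ge0.
have X20 : 0 <= X2 by exact: sqr_ge0.
have X30 : 0 <= X3 by exact: sqr_ge0.
have cross (c q y : R) : c ^+ 2 <= K -> 1 <= K * q ^+ 2 ->
    (c * y) ^+ 2 <= K * K * (q * y) ^+ 2.
  move=> cK qK; rewrite !exprMn; have y0 := sqr_ge0 y.
  apply: le_trans (ler_wpM2r y0 cK) _.
  by have := ler_wpM2l (ltW K0) (ler_wpM2r y0 qK); lra.
have c12 := cross _ _ y1 q12K q11K; have c13 := cross _ _ y1 q13K q11K.
have c23 := cross _ _ y2 q23K q22K.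
have crossP (z X : R) : z <= K * K * X -> (1 + t^-1) * z <= P * X.
  by move=> zX; rewrite /P -mulrA ler_wpM2l// addr_ge0 ?ltW.
have cross2 : (q13 * y1 + q23 * y2) ^+ 2 <= K * K * (2 * (X1 + X2)).
  have := sqr_ge0 (q13 * y1 - q23 * y2); rewrite /X1 /X2; nra.
pose Y2 := (q12 * y1 + q22 * y2) ^+ 2.
pose Y3 := (q13 * y1 + q23 * y2 + q33 * y3) ^+ 2.
have p12 := crossP _ _ c12; have p2 := crossP _ _ cross2.
have Y2le : Y2 <= (1 + t) * X2 + P * X1.
  rewrite /Y2 addrC; apply: le_trans (sqrD_le _ _ t0) _; rewrite lerD2l//.
have Y3le : Y3 <= (1 + t) * X3 + P * (2 * (X1 + X2)).
  by rewrite /Y3 addrC; apply: le_trans (sqrD_le _ _ t0) _; rewrite lerD2l.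
have X2le : X2 <= (1 + t) * Y2 + P * X1.
  rewrite /X2 -[q22 * y2](addKr (q12 * y1)) [- _ + _]addrC.
  by apply: le_trans (sqrD_le _ _ t0) _; rewrite sqrrN lerD2l.
have X3le : X3 <= (1 + t) * Y3 + P * (2 * (X1 + X2)).
  rewrite /X3 -[q33 * y3](addKr (q13 * y1 + q23 * y2)) [- _ + _]addrC.
  by apply: le_trans (sqrD_le _ _ t0) _; rewrite sqrrN lerD2l.
have DE : D = w1 * X1 + w2 * X2 + w3 * X3 by [].
have NE : N = w1 * X1 + w2 * Y2 + w3 * Y3 by [].
have w10 : 0 < w1 by exact: lt_le_trans w21.
have tX1 : 3 * P * w2 * X1 + t * w2 * X1 <= t * w1 * X1.
  by rewrite -mulrDl ler_wpM2r.
have tX2 : 3 * P * w3 * X2 + t * w3 * X2 <= t * w2 * X2.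
  by rewrite -mulrDl ler_wpM2r.
have PX : P * w3 * X1 <= P * w2 * X1 by rewrite ler_wpM2r// ler_wpM2l// ltW.
have nn (a b c : R) : 0 < a -> 0 < b -> 0 <= c -> 0 <= a * b * c.
  by move=> a0 b0 c0; apply: mulr_ge0 => //; apply/ltW/mulr_gt0.
have n1 := nn _ _ _ t0 w20 X10; have n2 := nn _ _ _ t0 w30 X20.
have n3 := nn _ _ _ t0 w30 X30; have n4 := nn _ _ _ P0 w30 X20.
have n5 := nn _ _ _ t0 w10 X10.
have ND : N <= (1 + 2 * t) * D.
  have := ler_wpM2l (ltW w20) Y2le; have := ler_wpM2l (ltW w30) Y3le.
  rewrite DE NE; lra.
have DN : D <= (1 + t) * N + t * D.
  have := ler_wpM2l (ltW w20) X2le; have := ler_wpM2l (ltW w30) X3le.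
  rewrite DE NE; lra.
have D0 : 0 <= D by rewrite DE !addr_ge0// mulr_ge0// ltW.
have N0 : 0 <= N by rewrite NE !addr_ge0// mulr_ge0 ?sqr_ge0// ltW.
split; first by apply: le_trans ND _; rewrite ler_wpM2r// et; lra.
have t1 : t <= 4^-1 by lra.
have tD : t * D <= 4^-1 * D by rewrite ler_wpM2r.
have ht : 0 <= (2 * t - 4 * t ^+ 2) by nra.
(* The term [t * D] moves to the left; [(1 - t) * (1 + 4 * t)] exceeds [1 + t] by
   [2 * t - 4 * t ^+ 2]. *)
have : (1 - t) * D <= (1 - t) * ((1 + e) * N).
  rewrite et; have : 0 <= (2 * t - 4 * t ^+ 2) * N by rewrite mulr_ge0.
  lra.
by rewrite ler_pM2l// subr_gt0; lra.
Qed.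

Lemma expr_close1 n e : 0 < e -> exists d : R, [/\ 0 < d, d <= 1 & (1 + d) ^+ n <= 1 + e].
Proof.
elim: n e => [|n IHn] e e0; first by exists 1; split; rewrite // expr0 lerDl ltW.
pose e1 := Num.min (e / 3) 1.
have e10 : 0 < e1 by rewrite lt_min divr_gt0//=.
have [e1e e11] : e1 <= e / 3 /\ e1 <= 1 by split; rewrite ge_min lexx ?orbT.
have [d [d0 _ dn]] := IHn _ e10; exists (Num.min d e1).
have [md me] : Num.min d e1 <= d /\ Num.min d e1 <= e1.
  by split; rewrite ge_min lexx ?orbT.
have m0 : 0 < Num.min d e1 by rewrite lt_min d0.
split=> //; first exact: le_trans me e11.
rewrite exprS; apply: (@le_trans _ _ ((1 + e1) * (1 + e1))); last nra.
apply: ler_pM; rewrite ?exprn_ge0 ?lerD2l//; [lra|lra|].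
by apply: le_trans dn; rewrite lerXn2r ?nnegrE; lra.
Qed.

Lemma bernoulli n (d : R) : 0 <= d -> 1 + n%:R * d <= (1 + d) ^+ n.
Proof.
move=> d0; elim: n => [|n IHn]; first by rewrite mul0r addr0 expr0.
rewrite exprS -natr1; have : 0 <= n%:R * d by rewrite mulr_ge0.
by have := ler_wpM2l (addr_ge0 ler01 d0) IHn; nra.
Qed.

Lemma expr_unbounded (d : R) x : 0 < d -> exists n, x < (1 + d) ^+ n.
Proof.
move=> d0; exists (Num.truncn (x / d)).+1.
apply: lt_le_trans (bernoulli _ (ltW d0)).
rewrite -[ltLHS]add0r ltrD// -ltr_pdivrMr//; exact: truncnS_gt.
Qed.

(** This rounded logarithm later turns real diagonal entries into integer shifts of exponents. *)
Lemma expr_bracket (d : R) x : 0 < d -> 1 <= x ->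
  exists2 m, (1 + d) ^+ m <= x & x < (1 + d) ^+ m.+1.
Proof.
move=> d0 x1; have := expr_unbounded x d0 => /ex_minnP[m xm mmin].
case: m xm mmin => [|m] xm mmin; first by rewrite expr0 ltNge x1 in xm.
by exists m => //; rewrite leNgt; apply/negP => /mmin; rewrite ltnn.
Qed.

End real_estimates.

(** * Orthonormal frames and summability of the weights *)

Section frames.
Variable R : realType.
Implicit Types (g h : SL 3) (A B q : 'M[R]_3) (w : 'I_3 -> R).

Lemma sum3E (V : zmodType) (F : 'I_3 -> V) : \sum_i F i = F 0 + F 1 + F 2%:R.
Proof.
rewrite !big_ord_recl big_ord0 addr0 addrA.
by congr (F _ + F _ + F _); apply: val_inj.
Qed.

Lemma forall3 (P : 'I_3 -> Prop) : P 0 -> P 1 -> P 2%:R -> forall i, P i.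
Proof.
move=> P0 P1 P2 [[|[|[|//]]] i3].
- by have -> : Ordinal i3 = 0 by exact: val_inj.
- by have -> : Ordinal i3 = 1 by exact: val_inj.
- by have -> : Ordinal i3 = 2%:R by exact: val_inj.
Qed.

Definition rmx g : 'M[R]_3 := map_mx intr (SL_mx g).

Lemma rmxM g h : rmx (g * h)%g = rmx g *m rmx h.
Proof. exact: map_mxM. Qed.

Lemma rmx1 : rmx 1%g = 1%:M.
Proof. exact: map_mx1. Qed.

Lemma rmxVK g : rmx g^-1%g *m rmx g = 1%:M.
Proof. by rewrite -rmxM mulVg rmx1. Qed.

Lemma rmxKV g : rmx g *m rmx g^-1%g = 1%:M.
Proof. by rewrite -rmxM mulgV rmx1. Qed.

Record frame := Frame {
  frame_mx :> 'M[R]_3;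
  frame_orthogonal : frame_mx^T *m frame_mx = 1%:M
}.
Implicit Types k : frame.

Lemma frame_mulmx_tr k : k *m k^T = 1%:M.
Proof. exact/mulmx1C/frame_orthogonal. Qed.

Lemma frame_entry_le1 k i j : `|(k : 'M[R]_3) i j| <= 1.
Proof.
have := congr1 (fun A : 'M[R]_3 => A j j) (frame_orthogonal k).
rewrite !mxE eqxx => kk; rewrite -(@ler_pXn2r _ 2)// ?nnegrE//.
rewrite expr1n -[leRHS]kk real_normK ?num_real// (bigD1 i)//= mxE -expr2 lerDl.
by apply: sumr_ge0 => l _; rewrite mxE -expr2 sqr_ge0.
Qed.

Definition wsqnorm w A : R := \sum_i \sum_j w j * A i j ^+ 2.

Lemma wsqnorm_ge0 w A : (forall j, 0 <= w j) -> 0 <= wsqnorm w A.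
Proof. by move=> w0; do 2!(apply: sumr_ge0 => ? _); rewrite mulr_ge0 ?sqr_ge0. Qed.

(** The unweighted form is the trace of [A *m A^T], and [k *m k^T] cancels in it. *)
Lemma wsqnorm_frame A k : wsqnorm (fun=> 1) (A *m k) = wsqnorm (fun=> 1) A.
Proof.
have tr B : wsqnorm (fun=> 1) B = \tr (B *m B^T).
  by apply: eq_bigr => i _; rewrite mxE; apply: eq_bigr => j _; rewrite mxE mul1r.
by rewrite !tr trmx_mul mulmxA -[A *m k *m _]mulmxA frame_mulmx_tr mulmx1.
Qed.

Lemma le_wsqnorm w w' A : (forall j, w j <= w' j) -> wsqnorm w A <= wsqnorm w' A.
Proof.
by move=> ww'; do 2!(apply: ler_sum => ? _); rewrite ler_wpM2r ?sqr_ge0.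
Qed.

(* The exponent is the number of entries, so that the weight is at most
   [\prod_(i, j) (1 + a_ij ^ 2)^-1] with [a] the matrix of [g^-1]. *)
Definition weight k w g : R := (1 + wsqnorm w (rmx g^-1%g *m k))^-1 ^+ 9.

(** The induction runs on the telescoping bound [3 - 2 / m.+1], an equality at [m = 0], whose
    increment dominates the next term. *)
Lemma sum_recip_sqr n : \sum_(i < n) (1 + (i%:R : R) ^+ 2)^-1 <= 3.
Proof.
suff H m : \sum_(i < m.+1) (1 + (i%:R : R) ^+ 2)^-1 <= 3 - 2 * m.+1%:R^-1.
  case: n => [|n]; first by rewrite big_ord0.
  by apply: le_trans (H n) _; rewrite lerBlDr lerDl mulr_ge0 ?invr_ge0.
elim: m => [|m IHm]; first by rewrite big_ord1 expr0n addr0 invr1; lra.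
rewrite big_ord_recr /=; apply: le_trans (lerD IHm (lexx _)) _.
rewrite -(natr1 m.+1) -(natr1 m); have m0 : 0 <= (m%:R : R) by [].
set x : R := m%:R; rewrite -/x in m0.
rewrite -lerBrDl; have -> : 3 - 2 * (x + 1 + 1)^-1 - (3 - 2 * (x + 1)^-1) =
    (((x + 1) * (x + 1 + 1)) / 2)^-1.
  by field; apply/andP; split; rewrite gt_eqF//; lra.
rewrite lef_pV2 ?posrE; last 2 first.
- by nra.
- by apply: divr_gt0 => //; apply: mulr_gt0; lra.
by rewrite ler_pdivrMr//; nra.
Qed.

(** The sum is extended to all assignments of a sign and a bounded absolute value to the nine
    positions. It then factors into nine sums, each at most [3 + 3], one 3 per sign. *)
Lemma sum_matrices_le (s : seq 'M[int]_3) : uniq s ->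
  \sum_(A <- s) \prod_(p : 'I_3 * 'I_3) (1 + ((A p.1 p.2)%:~R : R) ^+ 2)^-1
    <= 6 ^+ 9.
Proof.
move=> us; pose B := \max_(A <- s) \max_(p : 'I_3 * 'I_3) `|A p.1 p.2|%N.
pose code (A : 'M[int]_3) : {ffun 'I_3 * 'I_3 -> bool * 'I_B.+1} :=
  [ffun p => (A p.1 p.2 < 0, inord `|A p.1 p.2|%N)].
pose f (x : bool * 'I_B.+1) : R := (1 + (x.2%:R) ^+ 2)^-1.
have AB (A : 'M[int]_3) (p : 'I_3 * 'I_3) : A \in s -> (`|A p.1 p.2| < B.+1)%N.
  move=> As; rewrite ltnS; apply: leq_trans (leq_bigmax_seq _ As isT).
  exact: (leq_bigmax p).
have f0 x : 0 <= f x by rewrite invr_ge0 addr_ge0 ?sqr_ge0.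
have -> : \sum_(A <- s) \prod_(p : 'I_3 * 'I_3) (1 + ((A p.1 p.2)%:~R : R) ^+ 2)^-1 =
    \sum_(c <- map code s) \prod_p f (c p).
  rewrite big_map big_seq [RHS]big_seq; apply: eq_bigr => A As.
  apply: eq_bigr => p _; rewrite /f ffunE /= inordK ?AB//.
  by rewrite natr_absz intr_norm real_normK ?num_real.
have code_inj : {in s &, injective code}.
  move=> A A' As A's /ffunP E; apply/matrixP => i j.
  have := E (i, j); rewrite !ffunE /= => -[sgn /(congr1 (@nat_of_ord _))].
  rewrite !inordK ?(AB _ (i, j))// => abs.
  by rewrite [LHS]intEsign [RHS]intEsign sgn abs.
rewrite big_uniq ?map_inj_in_uniq//=.
apply: (@le_trans _ _ (\sum_(c : {ffun 'I_3 * 'I_3 -> bool * 'I_B.+1}) \prod_p f (c p))).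
  rewrite [leRHS](bigID (mem (map code s))) /= lerDl.
  by apply: sumr_ge0 => c _; apply: prodr_ge0.
rewrite -(bigA_distr_bigA (fun=> f)) prodr_const card_prod !card_ord.
rewrite lerXn2r ?nnegrE ?sumr_ge0//.
rewrite -(pair_bigA _ (fun (b : bool) (i : 'I_B.+1) => f (b, i))) /= big_bool /= /f /=.
by apply: le_trans (lerD (sum_recip_sqr _) (sum_recip_sqr _)) _; lra.
Qed.

(** As [w] is at least 1 and the unweighted form does not see the frame, each of the nine equal
    factors is at most the factor of one entry of [g^-1]. *)
Lemma weight_positive_summable k w :
  (forall j, 1 <= w j) -> positive_summable (weight k w).
Proof.
move=> w1; have f1 g : 1 <= 1 + wsqnorm w (rmx g^-1%g *m k).
  by rewrite lerDl wsqnorm_ge0// => j; apply: le_trans (w1 j).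
have W0 g : 0 < weight k w g by rewrite exprn_gt0// invr_gt0; exact: lt_le_trans (f1 g).
split=> //; exists (6 ^+ 9) => s us.
have inj : injective (fun g : SL 3 => SL_mx g^-1%g).
  by move=> g h /val_inj /invg_inj.
apply: le_trans (sum_matrices_le (s := map (fun g => SL_mx g^-1%g) s) _); last first.
  by rewrite map_inj_uniq.
rewrite big_map; apply: ler_sum => g _; rewrite ger0_norm; last exact: ltW.
have -> : weight k w g = \prod_(p : 'I_3 * 'I_3) (1 + wsqnorm w (rmx g^-1%g *m k))^-1.
  by rewrite prodr_const card_prod !card_ord.
apply: ler_prod => p _; rewrite invr_ge0 (le_trans _ (f1 g))//=.
rewrite lef_pV2 ?posrE; last 2 first.
- exact: lt_le_trans (f1 g).
- by rewrite ltr_pwDl// sqr_ge0.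
rewrite lerD2l; apply: (@le_trans _ _ (wsqnorm (fun=> 1) (rmx g^-1%g))); last first.
  by rewrite -(wsqnorm_frame _ k); exact: le_wsqnorm.
rewrite /wsqnorm (bigD1 p.1)//= (bigD1 p.2)//= mul1r !mxE -addrA lerDl.
by rewrite addr_ge0// ?sumr_ge0// => *; rewrite ?sumr_ge0// => *; rewrite mul1r sqr_ge0.
Qed.

End frames.

(** * Comparison of weights along a map of flags *)

Section comparison.
Variable R : realType.
Implicit Types (g h : SL 3) (A B q : 'M[R]_3) (w : 'I_3 -> R) (k : frame R).

Definition upper q := [/\ q 1 0 = 0, q 2%:R 0 = 0 & q 2%:R 1 = 0].

(** Rows are treated separately by [triangular_form_close]. One factor [1 + e] pays for dropping the
    off-diagonal entries of [q], the other for rounding [w i * q i i ^+ 2] to [w' i]. *)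
Lemma wsqnorm_compare (e K : R) : 0 < e -> e <= 1 -> 1 <= K ->
  exists2 M : R, 1 <= M & forall w w' q B,
    upper q -> (forall i j, q i j ^+ 2 <= K) -> (forall i, 1 <= K * q i i ^+ 2) ->
    0 < w 2%:R -> M * w 2%:R <= w 1 -> M * w 1 <= w 0 ->
    (forall i, w' i <= w i * q i i ^+ 2 <= (1 + e) * w' i) ->
    wsqnorm w (B *m q) <= (1 + e) ^+ 2 * wsqnorm w' B /\
    wsqnorm w' B <= (1 + e) ^+ 2 * wsqnorm w (B *m q).
Proof.
move=> e0 e1 K1; have [M M1 HM] := triangular_form_close e0 e1 K1.
exists M => // w w' q B [q10 q20 q21] qK qiK w2 w21 w10 ww'.
have e10 : 0 <= 1 + e by rewrite addr_ge0// ltW.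
have ee : 1 + e <= (1 + e) ^+ 2 by rewrite expr2 ler_peMl// lerDl ltW.
suff H i : \sum_j w j * (B *m q) i j ^+ 2 <=
      (1 + e) ^+ 2 * (\sum_j w' j * B i j ^+ 2) /\
    \sum_j w' j * B i j ^+ 2 <= (1 + e) ^+ 2 * (\sum_j w j * (B *m q) i j ^+ 2).
  by split; rewrite /wsqnorm mulr_sumr; apply: ler_sum => i _; case: (H i).
have [] := HM (w 0) (w 1) (w 2%:R) (q 0 0) (q 1 1) (q 2%:R 2%:R)
  (q 0 1) (q 0 2%:R) (q 1 2%:R) (B i 0) (B i 1) (B i 2%:R)
  w2 w21 w10 (qiK 0) (qiK 1) (qK 0 1) (qK 0 2%:R) (qK 1 2%:R).
set D := (X in _ <= _ * X); set N := (X in X <= _) => ND DN.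
have <- : N = \sum_j w j * (B *m q) i j ^+ 2.
  by rewrite sum3E !mxE !sum3E q10 q20 q21 /N; ring.
have DE : D = \sum_j (w j * q j j ^+ 2) * B i j ^+ 2 by rewrite sum3E /D; ring.
have w'D : \sum_j w' j * B i j ^+ 2 <= D.
  rewrite DE; apply: ler_sum => j _; rewrite ler_wpM2r ?sqr_ge0//.
  by case/andP: (ww' j).
have Dw' : D <= (1 + e) * \sum_j w' j * B i j ^+ 2.
  rewrite DE mulr_sumr; apply: ler_sum => j _; rewrite mulrA ler_wpM2r ?sqr_ge0//.
  by case/andP: (ww' j).
have N0 : 0 <= N.
  have w1 : 0 <= w 1.
    by apply: le_trans w21; rewrite mulr_ge0 ?(ltW w2)// (le_trans _ M1).
  have w0 : 0 <= w 0 by apply: le_trans w10; rewrite mulr_ge0// (le_trans _ M1).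
  by rewrite /N !addr_ge0// mulr_ge0 ?sqr_ge0// ltW.
split.
  apply: le_trans ND _; rewrite expr2 -mulrA ler_wpM2l//.
by apply: le_trans w'D _; apply: le_trans DN _; rewrite ler_wpM2r.
Qed.

Lemma weight_scale k k' w w' h h' (c : R) : 1 <= c ->
  (forall j, 0 <= w j) -> (forall j, 0 <= w' j) ->
  wsqnorm w' (rmx R h'^-1%g *m k') <= c * wsqnorm w (rmx R h^-1%g *m k) ->
  weight k w h <= c ^+ 9 * weight k' w' h'.
Proof.
move=> c1 w0 w'0 ff'; rewrite /weight.
set f := wsqnorm w _ in ff' *; set f' := wsqnorm w' _ in ff' *.
have f0 : 0 <= f by exact: wsqnorm_ge0.
have f'0 : 0 <= f' by exact: wsqnorm_ge0.
have c0 : 0 < c by exact: lt_le_trans c1.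
rewrite -exprMn lerXn2r ?nnegrE ?mulr_ge0 ?invr_ge0 ?addr_ge0 ?(ltW c0)//.
rewrite ler_pdivlMr ?ltr_pwDl// mulrC ler_pdivrMr ?ltr_pwDl//.
by rewrite mulrDr mulr1 lerD.
Qed.

Definition entry_norm A : R := \sum_i \sum_j `|A i j|.

(** Entries of a frame are at most 1 in absolute value, which makes the bound uniform in [k] and
    [k']. *)
Lemma frame_conj_le k k' A i j : `|(k'^T *m A *m k) i j| <= entry_norm A.
Proof.
rewrite mxE; apply: le_trans (ler_norm_sum _ _ _) _.
apply: (@le_trans _ _ (\sum_b \sum_a `|A a b|)); last by rewrite exchange_big.
apply: ler_sum => b _; rewrite normrM -[leRHS]mulr1.
apply: ler_pM => //; last exact: frame_entry_le1.
rewrite mxE; apply: le_trans (ler_norm_sum _ _ _) _; apply: ler_sum => a _.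
by rewrite mxE normrM -[leRHS]mul1r; apply: ler_pM => //; exact: frame_entry_le1.
Qed.

(* [g] maps the flag spanned by the first columns of [k] to that of [k']. *)
Definition maps_flag g k k' :=
  upper (k'^T *m rmx R g *m k) /\ upper (k^T *m rmx R g^-1%g *m k').

(** The two matrices are upper triangular and inverse to each other. An upper bound on one diagonal
    thus keeps the other away from 0. *)
Lemma maps_flag_diag g k k' i : maps_flag g k k' ->
  (k'^T *m rmx R g *m k) i i * (k^T *m rmx R g^-1%g *m k') i i = 1.
Proof.
set q := k'^T *m _ *m _; set r := k^T *m _ *m _ => -[[q10 q20 q21] [r10 r20 r21]].
have qr : q *m r = 1%:M.
  rewrite /q /r !mulmxA -[k'^T *m _ *m k *m _]mulmxA frame_mulmx_tr mulmx1.
  by rewrite -[k'^T *m _ *m _]mulmxA rmxKV mulmx1 frame_orthogonal.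
have := congr1 (fun A : 'M[R]_3 => A i i) qr; rewrite mxE sum3E [RHS]mxE eqxx.
move: i; apply: forall3; rewrite ?q10 ?q20 ?q21 ?r10 ?r20 ?r21;
  by rewrite ?(mul0r, mulr0, add0r, addr0).
Qed.

Definition power_weights (d : R) (a b c : nat) (j : 'I_3) : R :=
  (1 + d) ^+ nth 0%N [:: a; b; c] j.

Lemma power_weights_ge1 d a b c : 0 < d -> forall j, 1 <= power_weights d a b c j.
Proof. by move=> d0 j; rewrite exprn_ege1// lerDl ltW. Qed.

Definition frame_prob d (d0 : 0 < d) a b c k : prob R (SL 3) :=
  normalized (weight_positive_summable k (power_weights_ge1 a b c d0)).

(** With [q = k'^T g k] upper triangular, [(g^-1 h)^-1 k = h^-1 k' q]. The offset [I] leaves room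
    for diagonal entries below 1, exponents being natural numbers. Forms agree up to [(1 + e) ^+ 2],
    weights up to its ninth power, and normalizing squares this: exponent 36. *)
Lemma frame_prob_compare (e K : R) (e0 : 0 < e) (I : nat) :
    e <= 1 -> 1 <= K -> K <= (1 + e) ^+ I ->
  exists S : nat, forall g k k', maps_flag g k k' ->
    entry_norm (rmx R g) ^+ 2 <= K -> entry_norm (rmx R g^-1%g) ^+ 2 <= K ->
    exists m1 m2 m3, (m1 + m2 + m3 <= 6 * I)%N /\
      forall a b c : nat, (c + S <= b)%N -> (b + S <= a)%N ->
      l1_le (fun h => translate g (frame_prob e0 (a + I) (b + I) (c + I) k) h -
          frame_prob e0 (a + m1) (b + m2) (c + m3) k' h)
        (2 * ((1 + e) ^+ 36 - 1)).
Proof.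
move=> e1 K1 KI; have [M M1 HM] := wsqnorm_compare e0 e1 K1.
(* A gap of [S] between exponents separates consecutive weights by the factor [M] that
   [wsqnorm_compare] demands. *)
have [S MS] := expr_unbounded M e0; exists S => g k k' flag gK gVK.
have e10 : 0 < 1 + e by rewrite addr_gt0.
pose q := k'^T *m rmx R g *m k; pose r := k^T *m rmx R g^-1%g *m k'.
have sq_le A (x : R) : `|x| <= entry_norm A -> entry_norm A ^+ 2 <= K -> x ^+ 2 <= K.
  move=> xA; apply: le_trans; rewrite -real_normK ?num_real//.
  by rewrite lerXn2r ?nnegrE// (le_trans _ xA).
have qK i j : q i j ^+ 2 <= K by apply: (sq_le _ _ _ gK); exact: frame_conj_le.
have rK i j : r i j ^+ 2 <= K by apply: (sq_le _ _ _ gVK); exact: frame_conj_le.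
have qiK i : 1 <= K * q i i ^+ 2.
  have <- : (q i i * r i i) ^+ 2 = 1 by rewrite maps_flag_diag// expr1n.
  by rewrite exprMn mulrC ler_wpM2r ?sqr_ge0.
(* [m i] is the rounded logarithm of [q i i ^+ 2] to base [1 + e], raised by [I]; the two-sided
   bound on [q i i] keeps it between 0 and [2 * I]. *)
have /choice[m Hm] i : exists m, (m <= 2 * I)%N /\
    (1 + e) ^+ m <= (1 + e) ^+ I * q i i ^+ 2 < (1 + e) ^+ m.+1.
  have qI : 1 <= (1 + e) ^+ I * q i i ^+ 2.
    by apply: le_trans (qiK i) _; rewrite ler_wpM2r ?sqr_ge0.
  have [m mle mlt] := expr_bracket e0 qI; exists m; rewrite mle mlt; split=> //.
  have : (1 + e) ^+ m <= (1 + e) ^+ (2 * I); last by rewrite ler_eXn2l// ltrDl.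
  apply: le_trans mle _.
  rewrite mul2n -addnn exprD ler_wpM2l ?exprn_ge0 ?(ltW e10)//.
  exact: le_trans (qK i i) KI.
exists (m 0), (m 1), (m 2%:R); split.
  by have [[? _] [? _] [? _]] := And3 (Hm 0) (Hm 1) (Hm 2%:R); lia.
move=> a b c cb ba.
pose w := power_weights e (a + I) (b + I) (c + I).
pose w' := power_weights e (a + m 0) (b + m 1) (c + m 2%:R).
have w1 : forall j, 1 <= w j by exact: power_weights_ge1.
have w'1 : forall j, 1 <= w' j by exact: power_weights_ge1.
have w0 j : 0 <= w j by apply: le_trans (w1 j).
have w'0 j : 0 <= w' j by apply: le_trans (w'1 j).
have ww' i : w' i <= w i * q i i ^+ 2 <= (1 + e) * w' i.
  have H (x : nat) : (1 + e) ^+ (x + m i) <= (1 + e) ^+ (x + I) * q i i ^+ 2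
      <= (1 + e) * (1 + e) ^+ (x + m i).
    have [_ /andP[mle /ltW mlt]] := Hm i.
    rewrite !exprD -mulrA [X in _ <= _ <= X]mulrCA !ler_pM2l ?exprn_gt0//.
    by rewrite -exprS mle mlt.
  by move: i H; apply: forall3 => H; exact: H.
have Mw x y : (x + S <= y)%N -> M * (1 + e) ^+ (x + I) <= (1 + e) ^+ (y + I).
  move=> xy; apply: (@le_trans _ _ ((1 + e) ^+ S * (1 + e) ^+ (x + I))).
    by rewrite ler_wpM2r ?exprn_ge0// ltW.
  by rewrite -exprD ler_weXn2l ?lerDl ?(ltW e0)//; lia.
have FF h := HM w w' q (rmx R h^-1%g *m k') flag.1 qK qiK
  (lt_le_trans ltr01 (w1 _)) (Mw _ _ cb) (Mw _ _ ba) ww'.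
have qE h : rmx R h^-1%g *m k' *m q = rmx R (g^-1 * h)^-1%g *m k.
  rewrite /q !mulmxA -[_ *m k' *m _]mulmxA frame_mulmx_tr mulmx1.
  by rewrite -rmxM invgM invgK.
have c1 : 1 <= (1 + e) ^+ 2 by rewrite exprn_ege1// lerDl ltW.
have ps := weight_positive_summable k w1; have ps' := weight_positive_summable k' w'1.
have := normalized_dist (translate_positive_summable g ps) ps'
  (k := ((1 + e) ^+ 2) ^+ 9) (exprn_ege1 _ c1).
rewrite mass_translate// -!exprM; apply=> h.
  by rewrite exprM; apply: weight_scale => //; rewrite -qE; case: (FF h).
by rewrite exprM; apply: weight_scale => //; rewrite -qE; case: (FF h).
Qed.

End comparison.

(** * Averaged means on frames: almost equivariance and uniform continuity *)

Section frame_means.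
Variable R : realType.
Implicit Types (g h : SL 3) (A B E : 'M[R]_3) (w : 'I_3 -> R) (k : frame R).

Lemma l1_le_box_sumB (T : choiceType) L (F F' : nat -> nat -> nat -> T -> R) c :
  (forall i j l, (i < L)%N -> (j < L)%N -> (l < L)%N ->
    l1_le (fun x => F i j l x - F' i j l x) c) ->
  l1_le (fun x => box_sum L F x - box_sum L F' x) (L%:R ^+ 3 * c).
Proof.
move=> FF'; rewrite exprS expr2 -!mulrA.
apply: (l1_le_sumB (F := fun i x => _)) => i.
apply: (l1_le_sumB (F := fun i x => _)) => j.
by apply: (l1_le_sumB (F := fun i x => _)) => l; exact: FF'.
Qed.

Lemma l1_le_box_averageB L (L0 : (0 < L)%N)
    (F F' : nat -> nat -> nat -> prob R (SL 3)) c :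
  (forall i j l, (i < L)%N -> (j < L)%N -> (l < L)%N ->
    l1_le (fun x => F i j l x - F' i j l x) c) ->
  l1_le (fun x => box_average F L0 x - box_average F' L0 x) c.
Proof.
move=> /l1_le_box_sumB FF'.
have L3 : 0 < (L%:R : R) ^+ 3 by rewrite exprn_gt0// ltr0n.
rewrite -[c](mulKf (lt0r_neq0 L3)); apply: eq_l1_le (l1_leZ _ FF') => [x|].
  by rewrite mulrBr.
by rewrite invr_ge0 ltW.
Qed.

(** By Cauchy-Schwarz each squared entry of [B *m E] is at most [3 * d ^+ 2] times the form of its
    row, the weights being at least 1. The choice of [d] does not involve [B]. *)
Lemma wsqnorm_perturb (e V : R) : 0 < e -> 0 < V ->
  exists2 d : R, 0 < d & forall w B E,
    (forall j, 1 <= w j <= V) -> (forall i j, `|E i j| <= d) ->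
    wsqnorm w (B + B *m E) <= (1 + e) * wsqnorm w B.
Proof.
move=> e0 V0; have [t t0 et] : exists2 t : R, 0 < t & e = t + t.
  by exists (e / 2); [rewrite divr_gt0|field].
(* In the 9, one factor 3 comes from Cauchy-Schwarz on three terms, the other from summing over
   three columns. *)
pose u : R := (1 + t^-1) * (9 * V).
have u0 : 0 < u by rewrite !mulr_gt0// addr_gt0// invr_gt0.
exists (Num.min 1 (t / u)) => [|w B E wV Ed]; first by rewrite lt_min divr_gt0// ltr01.
set d := Num.min 1 (t / u) in Ed.
have d0 : 0 < d by rewrite lt_min divr_gt0// ltr01.
have d1 : d <= 1 by rewrite ge_min lexx.
have du : d <= t / u by rewrite ge_min lexx orbT.
have dd : u * d ^+ 2 <= t.
  rewrite -ler_pdivlMl// mulrC; apply: le_trans du.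
  by rewrite expr2 ler_piMl// ltW.
rewrite /wsqnorm mulr_sumr; apply: ler_sum => i _.
set X := \sum_j w j * B i j ^+ 2.
have BX : \sum_j B i j ^+ 2 <= X.
  by apply: ler_sum => j _; rewrite ler_peMl ?sqr_ge0//; case/andP: (wV j).
have BE j : (B *m E) i j ^+ 2 <= 3 * d ^+ 2 * X.
  have BEl l : (B i l * E l j) ^+ 2 <= d ^+ 2 * B i l ^+ 2.
    rewrite exprMn mulrC ler_wpM2r ?sqr_ge0// -[leLHS]real_normK ?num_real//.
    by rewrite lerXn2r ?nnegrE// ltW.
  apply: (@le_trans _ _ (3 * (\sum_l (B i l * E l j) ^+ 2))).
    rewrite mxE !sum3E; set x := _ * _; set y := _ * _; set z := _ * _.
    have := sqr_ge0 (x - y); have := sqr_ge0 (y - z); have := sqr_ge0 (x - z); lra.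
  rewrite -mulrA ler_pM2l//; apply: le_trans (ler_sum _ (fun l _ => BEl l)) _.
  by rewrite -mulr_sumr ler_wpM2l ?sqr_ge0.
have X0 : 0 <= X by apply: le_trans BX; apply: sumr_ge0 => j _; exact: sqr_ge0.
apply: (@le_trans _ _ (\sum_j ((1 + t) * (w j * B i j ^+ 2) +
    (1 + t^-1) * V * (3 * d ^+ 2 * X)))).
  apply: ler_sum => j _; have /andP[w1 wjV] := wV j.
  have w0 : 0 <= w j by apply: le_trans w1.
  rewrite [X in w j * X ^+ 2]mxE.
  apply: le_trans (ler_wpM2l w0 (sqrD_le _ _ t0)) _.
  rewrite mulrDr mulrCA lerD2l mulrCA -mulrA ler_pM2l ?addr_gt0 ?invr_gt0//.
  by apply: ler_pM => //; exact: sqr_ge0.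
rewrite big_split /= -mulr_sumr sumr_const card_ord -/X.
have := ler_wpM2r X0 dd; rewrite et /u -mulr_natl; lra.
Qed.

Lemma frame_near k k' (d : R) :
  (forall i j, `|(k' : 'M[R]_3) i j - (k : 'M[R]_3) i j| <= d) ->
  exists2 E : 'M[R]_3, (forall i j, `|E i j| <= 3 * d) &
    (k' : 'M[R]_3) = (k : 'M[R]_3) + (k : 'M[R]_3) *m E.
Proof.
move=> kk'; exists (k^T *m ((k' : 'M[R]_3) - (k : 'M[R]_3))); last first.
  by rewrite mulmxA frame_mulmx_tr mul1mx addrC subrK.
move=> i j; rewrite mxE; apply: le_trans (ler_norm_sum _ _ _) _.
rewrite -[leRHS]/(3%:R * d) -[X in X%:R]card_ord -sum1_card natr_sum mulr_suml.
apply: ler_sum => l _; rewrite normrM; apply: ler_pM => //.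
  by rewrite mxE frame_entry_le1.
by have := kk' l j; rewrite !mxE.
Qed.

(** Nearby frames differ by a right factor close to the identity, by [frame_near]. The weights
    change by at most [(1 + f) ^+ 9], and normalizing squares this: exponent 18. *)
Lemma frame_prob_continuous (e : R) (e0 : 0 < e) n (eta : R) : 0 < eta ->
  exists2 d : R, 0 < d & forall a b c k k',
    (a <= n)%N -> (b <= n)%N -> (c <= n)%N ->
    (forall i j, `|(k' : 'M[R]_3) i j - (k : 'M[R]_3) i j| <= d) ->
    l1_le (fun h => frame_prob e0 a b c k' h - frame_prob e0 a b c k h) eta.
Proof.
move=> eta0; have [f [f0 _ fe]] := expr_close1 18 (divr_gt0 eta0 (ltr0n R 2)).
have e10 : 0 < 1 + e by rewrite addr_gt0.
have [d d0 Hd] := wsqnorm_perturb f0 (exprn_gt0 n e10).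
exists (d / 3) => [|a b c k k' an bn cn kk']; first by rewrite divr_gt0.
pose w := power_weights e a b c.
have w1 j : 1 <= w j by exact: power_weights_ge1.
have w0 j : 0 <= w j by apply: le_trans (w1 j).
have wV j : 1 <= w j <= (1 + e) ^+ n.
  rewrite w1 /w /power_weights /= ler_weXn2l ?lerDl ?(ltW e0)//.
  by move: j; apply: forall3.
have step k1 k2 : (forall i j, `|(k2 : 'M[R]_3) i j - (k1 : 'M[R]_3) i j| <= d / 3) ->
    forall h, weight k1 w h <= (1 + f) ^+ 9 * weight k2 w h.
  move=> /frame_near[E Ed k2E] h.
  apply: weight_scale => //; first by rewrite lerDl ltW.
  rewrite k2E mulmxDr mulmxA; apply: Hd => // i j.
  by apply: le_trans (Ed i j) _; rewrite mulrC divfK.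
have f9 : 1 <= (1 + f) ^+ 9 by rewrite exprn_ege1// lerDl ltW.
apply: l1_leW (normalized_dist (weight_positive_summable k' w1)
  (weight_positive_summable k w1) f9 _ _).
- by rewrite -exprM; lra.
- by apply: step => i j; rewrite distrC.
- exact: step.
Qed.

(** The shift in [frame_prob_compare] depends on [g], [k], [k'] but not on the exponents, so it
    moves the whole cube of exponents rigidly; for a large side [L] the average hardly changes. *)
Lemma frame_mean_exists (N eps : R) : 0 <= N -> 0 < eps ->
  exists mu : frame R -> prob R (SL 3),
    (forall g k k', maps_flag g k k' ->
      entry_norm (rmx R g) <= N -> entry_norm (rmx R g^-1%g) <= N ->
      l1_le (fun h => translate g (mu k) h - mu k' h) eps) /\
    (forall eta : R, 0 < eta -> exists2 d : R, 0 < d & forall k k',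
      (forall i j, `|(k' : 'M[R]_3) i j - (k : 'M[R]_3) i j| <= d) ->
      forall h, `|mu k' h - mu k h| <= eta).
Proof.
move=> N0 eps0; have [e [e0 e1 ee]] := expr_close1 36 (divr_gt0 eps0 (ltr0n R 4)).
pose K := 1 + N ^+ 2; have K1 : 1 <= K by rewrite lerDl sqr_ge0.
have [I /ltW KI] := expr_unbounded K e0.
have [S HS] := frame_prob_compare e0 e1 K1 KI.
(* The cube is moved by at most [6 * I], then by [3 * I], in total. This costs [18 * I / L], which
   the choice of [L] makes at most [eps / 2]. *)
pose L := (Num.truncn (36 * I%:R / eps)).+1.
have L0 : (0 < L)%N by [].
have sep x y : (x < L)%N -> (x + S <= y + (L + S))%N.
  by move=> xL; rewrite addnA leq_add2r (leq_trans (ltnW xL))// leq_addl.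
have LI : 18 * I%:R / L%:R <= eps / 2.
  have : 36 * I%:R / eps < L%:R by exact: truncnS_gt.
  rewrite ltr_pdivrMr// ler_pdivrMr ?ltr0n// => /ltW; lra.
(* The corner [(2 * (L + S), L + S, 0)] keeps consecutive exponents at least [S] apart throughout
   the cube. *)
pose F k i j l := frame_prob e0 (i + (L + S) + (L + S)) (j + (L + S)) l k.
pose mu k := box_average (fun i j l => F k (i + I)%N (j + I)%N (l + I)%N) L0.
exists mu; split; last first.
  move=> eta eta0.
  have [d d0 Hd] := frame_prob_continuous e0 (L + I + (L + S) + (L + S)) eta0.
  exists d => // k k' kk' h.
  apply: (@l1_le_ge _ _ (fun h => mu k' h - mu k h)).
  apply: l1_le_box_averageB => i j l iL jL lL; apply: Hd => //.
  - by rewrite !leq_add2r ltnW.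
  - by apply: leq_trans (leq_addr _ _); rewrite !leq_add2r ltnW.
  - by rewrite -!addnA; apply: leq_add; [exact: ltnW|exact: leq_addr].
move=> g k k' flag gN gVN.
have sqK A : entry_norm A <= N -> entry_norm A ^+ 2 <= K.
  move=> AN; apply: (@le_trans _ _ (N ^+ 2)); last by rewrite lerDr.
  by rewrite lerXn2r ?nnegrE// /entry_norm !sumr_ge0// => *; rewrite sumr_ge0.
have [m1 [m2 [m3 [mI Hm]]]] := HS g k k' flag (sqK _ gN) (sqK _ gVN).
set eps1 := 2 * _ in Hm.
have eps1e : eps1 <= eps / 2 by rewrite /eps1; lra.
have L3 : 0 < (L%:R : R) ^+ 3 by rewrite exprn_gt0// ltr0n.
(* Three steps lead from [translate g (mu k)] to [mu k']: replace [k] by [k'] termwise with shift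
   [(m1, m2, m3)], undo that shift, then shift by [(I, I, I)]. *)
have s1 : l1_le (fun h =>
    box_sum L (fun i j l => translate g (F k (i + I)%N (j + I)%N (l + I)%N)) h -
    box_sum L (fun i j l => F k' (i + m1)%N (j + m2)%N (l + m3)%N) h) (L%:R ^+ 3 * eps1).
  apply: l1_le_box_sumB => i j l iL jL lL.
  have := Hm (i + (L + S) + (L + S))%N (j + (L + S))%N l.
  have aC x y : (x + y + (L + S) = x + (L + S) + y)%N by rewrite addnAC.
  rewrite /F !aC; apply; first exact: sep.
  by rewrite addnAC leq_add2r sep.
have Fl i j l : l1_le (F k' i j l) 1 by exact: prob_l1_le.
have s2 := l1_le_box_shift L m1 m2 m3 Fl.
have s3 := l1_leN (l1_le_box_shift L I I I Fl).
have {}s3 := eq_l1_le (fun x => opprB _ _) s3.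
have L3V : 0 <= (L%:R ^+ 3)^-1 :> R by rewrite invr_ge0 ltW.
have := l1_leZ L3V (l1_le_trans (l1_le_trans s1 s2) s3).
move=> s; apply: (@l1_leW _ _ _ _ eps _ (eq_l1_le _ s)) => [|h]; last first.
  by rewrite mulrBr.
rewrite ler_pdivrMl//; have mI' : (m1 + m2 + m3)%:R <= 6 * I%:R :> R.
  by rewrite -natrM ler_nat.
have Lpos : 0 < L%:R :> R by rewrite ltr0n.
have L2 : 0 <= L%:R * L%:R :> R by rewrite mulr_ge0.
have := ler_wpM2r L2 mI'; have := ler_wpM2l (ltW L3) eps1e.
rewrite ler_pdivrMr// in LI; have := ler_wpM2r L2 LI.
have I3 : (I + I + I)%:R = 3 * I%:R :> R by rewrite !natrD; ring.
rewrite I3 exprS expr2; lra.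
Qed.

End frame_means.

(** * Limits along ultrafilters *)

Lemma continuous_prob (R : realType) (G : groupType) (X : topologicalType)
    (f : X -> prob R G) :
  (forall h, continuous (fun x => f x h)) -> continuous f.
Proof.
move=> fc; apply: continuous_comp_initial => x; apply/cvg_sup => h U.
move=> [_ [[W oW <-] Wx] WU]; apply: (filterS WU).
by apply: (fc h x); exact: open_nbhs_nbhs.
Qed.

Section ultralimits.
Variables (R : realType) (Z : Type).
Implicit Types (w : beta Z) (f : Z -> R).

Definition bounded_fct f := exists c : R, forall z, `|f z| <= c.

Definition ulim f w : R := lim (f @ ultra w).

(** The values lie in a compact interval, where every ultrafilter converges. *)
Lemma ulim_cvg f w : bounded_fct f -> f @ ultra w --> ulim f w.
Proof.
move=> [c fc]; have := @segment_compact R (- c) c; rewrite compact_ultra.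
move=> /(_ _ (fmap_ultra f (ultraP w)))[|l [_ fl]]; last exact: (cvgP l fl).
have wT : ultra w setT by exact: filterT.
by apply: filterS wT => z _; rewrite /= in_itv /= -ler_norml fc.
Qed.

Lemma ulimE f w l : f @ ultra w --> l -> ulim f w = l.
Proof. by move=> fl; apply: cvg_lim fl; exact: norm_hausdorff. Qed.

Lemma eq_ulim f f' w : f =1 f' -> ulim f w = ulim f' w.
Proof. by move=> /funext ->. Qed.

Lemma ulim_cst c w : ulim (fun=> c) w = c.
Proof. by apply: ulimE; exact: cvg_cst. Qed.

Lemma ulimM f f' w : bounded_fct f -> bounded_fct f' ->
  ulim (fun z => f z * f' z) w = ulim f w * ulim f' w.
Proof. by move=> fb f'b; apply: ulimE; apply: cvgM; exact: ulim_cvg. Qed.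

Lemma ulim_sum n (F : 'I_n -> Z -> R) w : (forall i, bounded_fct (F i)) ->
  ulim (fun z => \sum_i F i z) w = \sum_i ulim (F i) w.
Proof.
move=> Fb; apply: ulimE; elim: (index_enum _) => [|i r IHr].
  by rewrite big_nil; under eq_fun do rewrite big_nil; exact: cvg_cst.
rewrite big_cons; under eq_fun do rewrite big_cons.
by apply: cvgD => //; exact: ulim_cvg.
Qed.

Lemma bounded_fctM f f' : bounded_fct f -> bounded_fct f' ->
  bounded_fct (fun z => f z * f' z).
Proof.
by move=> [c fc] [c' f'c]; exists (c * c') => z; rewrite normrM ler_pM.
Qed.

Lemma bounded_fct_cst c : bounded_fct (fun=> c).
Proof. by exists `|c|. Qed.

Lemma ulim_near f w (c e : R) : bounded_fct f ->
  ultra w [set z | `|f z - c| <= e] -> `|ulim f w - c| <= e.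
Proof.
move=> fb we; apply/ler_addgt0Pr => d d0.
have /cvgrPdist_le/(_ _ d0) wd := ulim_cvg (w := w) fb.
have [z [/= fe fd]] := filter_ex (filterI we wd).
by rewrite [leRHS]addrC; apply: le_trans (ler_distD (f z) _ _) (lerD fd fe).
Qed.

(** The set where [f] is near its limit along [w] belongs to [w], so it defines a basic
    neighbourhood on which [ulim f] stays near. *)
Lemma ulim_continuous f : bounded_fct f -> continuous (ulim f).
Proof.
move=> fb w U /nbhs_ballP[e /= e0 eU]; apply/beta_nbhs.
have e20 : 0 < e / 2 by rewrite divr_gt0.
exists [set z | `|f z - ulim f w| <= e / 2] => [|v ve].
  have /cvgrPdist_le/(_ _ e20) := ulim_cvg (w := w) fb.
  by apply: filterS => z /=; rewrite distrC.
apply: eU; rewrite /ball /= distrC; apply: le_lt_trans (ulim_near fb ve) _.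
by rewrite ltr_pdivrMr// ltr_pMr// ltr1n.
Qed.

End ultralimits.

(** An ultrafilter containing a finite set contains one of its singletons, hence is principal. *)
Lemma free_ultra_cofinite (Z : choiceType) (w : beta Z) (E : set Z) :
  beta_boundary w -> finite_set (~` E) -> ultra w E.
Proof.
move=> wfree; have [//|wEc] := in_ultra_setVsetC E (ultraP w).
move=> /finite_seqP[s Es]; rewrite {}Es in wEc; exfalso.
elim: s wEc => [|z s IHs] ws.
  by apply: (filter_not_empty (ultra w)); apply: filterS ws => x; rewrite /= in_nil.
have [wz|wzc] := in_ultra_setVsetC [set z] (ultraP w).
  apply: wfree; exists z => //; apply: beta_inj; apply/esym.
  apply: (@max_filter _ _ (principal_filter_ultra z)).
  by move=> A /principal_filterP Az; apply: filterS wz => _ ->.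
apply: IHs; apply: filterS (filterI ws wzc) => x /= [].
by rewrite inE => /orP[/eqP //|].
Qed.

(** * The flag of a free ultrafilter on the coset space *)

Section frame_of_flag.
Variable R : realType.
Implicit Types u v p : 'I_3 -> R.

Definition dot u v : R := \sum_i u i * v i.

Definition cross u v (i : 'I_3) : R :=
  nth 0 [:: u 1 * v 2%:R - u 2%:R * v 1; u 2%:R * v 0 - u 0 * v 2%:R;
            u 0 * v 1 - u 1 * v 0] i.

(** For orthogonal [v] and [p], the flag is the line of [v] inside the plane orthogonal to [p]; the
    cross product completes the frame continuously. *)
Definition flag_mx v p : 'M[R]_3 :=
  \matrix_(i, j) nth v [:: v; cross p v; p] j i.

Lemma flag_mxE v p : [/\ forall i, flag_mx v p i 0 = v i,
  forall i, flag_mx v p i 1 = cross p v i & forall i, flag_mx v p i 2%:R = p i].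
Proof. by split=> i; rewrite mxE. Qed.

Lemma flag_mx_orthogonal v p : dot v v = 1 -> dot p p = 1 -> dot p v = 0 ->
  (flag_mx v p)^T *m flag_mx v p = 1%:M.
Proof.
rewrite /dot !sum3E => vv pp pv; move: (flag_mx v p) (flag_mxE v p) => k [k0 k1 k2].
apply/matrixP => i j; rewrite mxE sum3E !mxE.
have crossE : [/\ cross p v 0 = p 1 * v 2%:R - p 2%:R * v 1,
  cross p v 1 = p 2%:R * v 0 - p 0 * v 2%:R &
  cross p v 2%:R = p 0 * v 1 - p 1 * v 0] by [].
have [c0 c1 c2] := crossE.
(* Lagrange's identity for the squared length of a cross product. *)
have cc : cross p v 0 * cross p v 0 + cross p v 1 * cross p v 1 +
    cross p v 2%:R * cross p v 2%:R = 1.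
  have -> : 1 = (p 0 * p 0 + p 1 * p 1 + p 2%:R * p 2%:R) *
      (v 0 * v 0 + v 1 * v 1 + v 2%:R * v 2%:R) -
      (p 0 * v 0 + p 1 * v 1 + p 2%:R * v 2%:R) ^+ 2.
    by rewrite vv pp pv expr0n mulr1 subr0.
  by rewrite c0 c1 c2; ring.
by move: i; apply: forall3; move: j; apply: forall3; rewrite ?k0 ?k1 ?k2;
  first [exact: vv | exact: pp | exact: cc
        | transitivity (0 : R) => //; rewrite ?c0 ?c1 ?c2;
          first [ring | rewrite -pv; ring]].
Qed.

End frame_of_flag.

Section euclidean_norm.
Variable R : realType.
Implicit Types (u v : 'I_3 -> R) (A : 'M[R]_3) (k : frame R).

(** The first hypothesis determines column 0 of the conjugate, the second its row 2; together they
    cover the three entries below the diagonal. *)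
Lemma upper_frames k k' A (r s : R) :
  (forall a, \sum_b A a b * (k : 'M[R]_3) b 0 = r * (k' : 'M[R]_3) a 0) ->
  (forall b, \sum_a (k' : 'M[R]_3) a 2%:R * A a b = s * (k : 'M[R]_3) b 2%:R) ->
  upper (k'^T *m A *m k).
Proof.
move=> Ak k'A.
have col0 i : (k'^T *m A *m k) i 0 = r * (i == 0)%:R.
  have := congr1 (fun B : 'M[R]_3 => B i 0) (frame_orthogonal k').
  rewrite /= [RHS]mxE => <-; rewrite -mulmxA !mxE mulr_sumr.
  by apply: eq_bigr => a _; rewrite [(A *m k) a 0]mxE Ak mulrCA.
have row2 : (k'^T *m A *m k) 2%:R 1 = s * (2%:R == 1 :> 'I_3)%:R.
  have := congr1 (fun B : 'M[R]_3 => B 2%:R 1) (frame_orthogonal k).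
  rewrite /= [RHS]mxE => <-; rewrite !mxE mulr_sumr.
  apply: eq_bigr => b _; rewrite mulrA; congr (_ * _).
  by rewrite !mxE -k'A; apply: eq_bigr => a _; rewrite mxE.
by split; rewrite ?col0 ?row2 mulr0.
Qed.

Definition nrm u : R := Num.sqrt (dot u u).

Lemma dot_ge0 u : 0 <= dot u u.
Proof. by apply: sumr_ge0 => i _; rewrite -expr2 sqr_ge0. Qed.

Lemma nrm_ge0 u : 0 <= nrm u.
Proof. exact: sqrtr_ge0. Qed.

Lemma sqr_nrm u : nrm u ^+ 2 = dot u u.
Proof. by rewrite sqr_sqrtr ?dot_ge0. Qed.

Lemma entry_le_nrm u i : `|u i| <= nrm u.
Proof.
rewrite -(@ler_pXn2r _ 2)// ?nnegrE ?nrm_ge0// sqr_nrm real_normK ?num_real//.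
by rewrite /dot (bigD1 i)//= -expr2 lerDl sumr_ge0// => j _; rewrite -expr2 sqr_ge0.
Qed.

Lemma nrm_le_sum u : nrm u <= \sum_i `|u i|.
Proof.
have s0 : 0 <= \sum_i `|u i| by exact: sumr_ge0.
rewrite -(@ler_pXn2r _ 2)// ?nnegrE ?nrm_ge0// sqr_nrm expr2 mulr_suml.
apply: ler_sum => i _; apply: le_trans (ler_norm _) _; rewrite normrM.
by rewrite ler_wpM2l// (bigD1 i)//= lerDl sumr_ge0.
Qed.

Lemma nrm_mulmx A u v : (forall i, v i = \sum_j A i j * u j) ->
  nrm v <= entry_norm A * nrm u.
Proof.
move=> vA; apply: le_trans (nrm_le_sum v) _; rewrite /entry_norm mulr_suml.
apply: ler_sum => i _; rewrite vA; apply: le_trans (ler_norm_sum _ _ _) _.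
rewrite mulr_suml; apply: ler_sum => j _.
by rewrite normrM ler_wpM2l// entry_le_nrm.
Qed.

Definition normalize u i : R := u i / nrm u.

Lemma normalize_le1 u i : `|normalize u i| <= 1.
Proof.
(* At norm 0 the inverse is 0 by convention, so the quotient vanishes. *)
have [u0|u0] := eqVneq (nrm u) 0; first by rewrite /normalize u0 invr0 mulr0 normr0.
have un : 0 < nrm u by rewrite lt_neqAle eq_sym u0 nrm_ge0.
rewrite /normalize normrM [`|_^-1|]ger0_norm ?invr_ge0 ?nrm_ge0//.
by rewrite ler_pdivrMr// mul1r entry_le_nrm.
Qed.

Lemma dot_normalize u v :
  dot (normalize u) (normalize v) = dot u v * ((nrm u)^-1 * (nrm v)^-1).
Proof. by rewrite /dot mulr_suml; apply: eq_bigr => i _; rewrite mulrACA. Qed.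

Lemma dot_normalize_id u : nrm u != 0 -> dot (normalize u) (normalize u) = 1.
Proof. by move=> u0; rewrite dot_normalize -sqr_nrm -invfM -expr2 divff// expf_neq0. Qed.

Lemma nrm_ge1 u i : u i \is a Num.int -> u i != 0 -> 1 <= nrm u.
Proof.
move=> ui u0; apply: le_trans (entry_le_nrm u i).
by rewrite norm_intr_ge1.
Qed.

End euclidean_norm.

(** * Cosets as pairs of integer vectors *)

Section coset_geometry.
Variable R : realType.
Local Notation H := SL2_in_SL3.
Local Notation Z := (left_cosets H).
Local Notation act := (coset_action H).
Implicit Types (g h : SL 3) (z : Z).

(** In this form, right multiplication by [H] visibly preserves the first column of [g] and the
    first row of [g^-1]. *)
Lemma SL2_in_SL3P h : H h <->
  (forall i, SL_mx h i 0 = (i == 0)%:R) /\ (forall j, SL_mx h 0 j = (j == 0)%:R).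
Proof.
have inl : lshift 2 0 = 0 :> 'I_(1 + 2) by exact: val_inj.
have inr (i : 'I_2) : (rshift 1 i == 0 :> 'I_(1 + 2)) = false by [].
split=> [[A hA]|[h0 h0']].
  have E : forall B : 'M[int]_(1 + 2), B = block_mx 1%:M 0 0 (SL_mx A) ->
      (forall i, B i 0 = (i == 0)%:R) /\ (forall j, B 0 j = (j == 0)%:R).
    move=> _ ->; split=> i; rewrite -{1}inl; case: (split_ordP i) => i' ->.
    - by rewrite block_mxEul mxE !ord1 inl.
    - by rewrite block_mxEdl mxE inr.
    - by rewrite block_mxEul mxE !ord1 inl.
    - by rewrite block_mxEur mxE inr.
  exact: E hA.
pose M : 'M[int]_(1 + 2) := SL_mx h.
have ME : M = block_mx 1%:M 0 0 (drsubmx M).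
  rewrite -[LHS]submxK; congr block_mx; apply/matrixP => i j; rewrite !mxE.
  - by rewrite !ord1 inl; exact: h0.
  - by rewrite ord1 inl; apply: (etrans (h0' _)); rewrite inr.
  - by rewrite ord1 inl; apply: (etrans (h0 _)); rewrite inr.
have dA : \det (drsubmx M) == 1.
  have : \det M == 1 := SL_det h.
  by rewrite [X in \det X == 1 -> _]ME det_ublock det1 mul1r.
by exists (MkSL dA).
Qed.

Lemma rep_exists z : exists g, val z = [set (g * h)%g | h in H].
Proof. exact: set_mem (valP z). Qed.

Definition rep z : SL 3 := projT1 (cid (rep_exists z)).

Lemma repE z : val z = [set (rep z * h)%g | h in H].
Proof. exact: projT2 (cid (rep_exists z)). Qed.

Lemma rep_act g z : exists2 h, H h & rep (act g z) = (g * rep z * h)%g.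
Proof.
have : val (act g z) (rep (act g z)).
  by rewrite repE; exists 1%g; [case: SL2_in_SL3_subgroup|rewrite mulg1].
by rewrite /= => -[x]; rewrite repE => -[h Hh <-] <-; exists h; rewrite // mulgA.
Qed.

Lemma rmxE g i j : rmx R g i j = (SL_mx g i j)%:~R.
Proof. by rewrite mxE. Qed.

Definition colv z i : R := rmx R (rep z) i 0.
Definition rowv z j : R := rmx R (rep z)^-1%g 0 j.

Lemma rmx_col0 h i : H h -> rmx R h i 0 = (i == 0)%:R.
Proof. by move=> /SL2_in_SL3P[h0 _]; rewrite mxE h0; case: eqP. Qed.

Lemma rmx_row0 h j : H h -> rmx R h 0 j = (j == 0)%:R.
Proof. by move=> /SL2_in_SL3P[_ h0]; rewrite mxE h0; case: eqP. Qed.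

Lemma colv_act g z i : colv (act g z) i = \sum_j rmx R g i j * colv z j.
Proof.
rewrite /colv; have [h Hh ->] := rep_act g z; rewrite !rmxM mxE (bigD1 0)//=.
rewrite rmx_col0// mulr1 big1 ?addr0 ?mxE// => j /negPf j0.
by rewrite rmx_col0// j0 mulr0.
Qed.

(** The row transforms by [g^-1]; moving [g] to the other side gives the shape required by
    [upper_frames]. *)
Lemma rowv_act g z j : rowv z j = \sum_l rowv (act g z) l * rmx R g l j.
Proof.
transitivity ((rmx R (rep (act g z))^-1%g *m rmx R g) 0 j); last by rewrite mxE.
have [h Hh ->] := rep_act g z.
have Hh' : H h^-1%g by case: SL2_in_SL3_subgroup => _ _; exact.
rewrite -rmxM !invgM -!mulgA mulVg mulg1 rmxM mxE (bigD1 0)//=.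
rewrite rmx_row0// mul1r big1 ?addr0// => l /negPf l0.
by rewrite rmx_row0// l0 mul0r.
Qed.

Lemma dot_rowv_colv z : dot (rowv z) (colv z) = 1.
Proof.
have := congr1 (fun A : 'M[R]_3 => A 0 0) (rmxVK R (rep z)).
by rewrite /= !mxE eqxx.
Qed.

(** The vector is integral, and nonzero because it pairs to 1 with [rowv z]. *)
Lemma nrm_colv_ge1 z : 1 <= nrm (colv z).
Proof.
have [i ui] : exists i, colv z i != 0.
  apply: contrapT => /forallNP ui; have := dot_rowv_colv z.
  rewrite /dot big1 => [/esym/eqP|i _]; first by rewrite oner_eq0.
  by have /negP/negPn/eqP -> := ui i; rewrite mulr0.
by apply: nrm_ge1 ui; rewrite /colv mxE intr_int.
Qed.

Lemma nrm_rowv_ge1 z : 1 <= nrm (rowv z).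
Proof.
have [i ui] : exists i, rowv z i != 0.
  apply: contrapT => /forallNP ui; have := dot_rowv_colv z.
  rewrite /dot big1 => [/esym/eqP|i _]; first by rewrite oner_eq0.
  by have /negP/negPn/eqP -> := ui i; rewrite mul0r.
by apply: nrm_ge1 ui; rewrite /rowv mxE intr_int.
Qed.

(** Equal columns give [(rep z)^-1 * rep z'] the first column of the identity, equal rows the first
    row, so it lies in [H]. *)
Lemma colv_rowv_inj z z' : colv z =1 colv z' -> rowv z =1 rowv z' -> z = z'.
Proof.
move=> cc rr; pose h := ((rep z)^-1 * rep z')%g.
have Hh : H h.
  apply/SL2_in_SL3P; split=> i; apply: (@intr_inj R); rewrite -rmxE /h rmxM mxE.
    have := congr1 (fun A : 'M[R]_3 => A i 0) (rmxVK R (rep z)).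
    rewrite /= mxE [RHS]mxE => E; transitivity ((i == 0)%:R : R); last by case: eqP.
    by rewrite -E; apply: eq_bigr => j _; congr (_ * _); exact/esym/cc.
  have := congr1 (fun A : 'M[R]_3 => A 0 i) (rmxVK R (rep z')).
  rewrite /= mxE [RHS]mxE => E; transitivity ((0 == i)%:R : R).
    by rewrite -E; apply: eq_bigr => j _; congr (_ * _); exact/rr.
  by rewrite eq_sym; case: eqP.
have [_ HM HV] := SL2_in_SL3_subgroup.
apply: val_inj; rewrite !repE; apply/seteqP; split=> _ [x Hx <-].
  exists (h^-1 * x)%g; first by apply: HM => //; exact: HV.
  by rewrite /h invgM invgK -!mulgA mulVKg.
by exists (h * x)%g; [exact: HM|rewrite /h -mulgA mulVKg].
Qed.

(** Bounded integers are coded by a sign and finitely many absolute values; by [colv_rowv_inj] the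
    codes of both vectors determine the coset. *)
Lemma finite_bounded_cosets (c : R) :
  finite_set [set z | forall i, `|colv z i| <= c /\ `|rowv z i| <= c].
Proof.
set A := [set z | _]; pose B := Num.truncn c.
pose icol z i : int := SL_mx (rep z) i 0.
pose irow z i : int := SL_mx (rep z)^-1%g 0 i.
pose enc (m : int) : bool * 'I_B.+1 := (m < 0, inord `|m|%N).
have enc_inj (m m' : int) : `|m%:~R : R| <= c -> `|m'%:~R : R| <= c ->
    enc m = enc m' -> m = m'.
  have mB (n : int) : `|n%:~R : R| <= c -> (`|n|%N < B.+1)%N.
    by move=> nc; rewrite ltnS truncn_ge_nat ?natr_absz ?intr_norm// (le_trans _ nc).
  move=> mc m'c [sgn /(congr1 (@nat_of_ord _))]; rewrite !inordK ?mB// => abs.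
  by rewrite [LHS]intEsign [RHS]intEsign sgn abs.
pose code z := [ffun i => (enc (icol z i), enc (irow z i))].
have code_inj : {in A &, injective code}.
  move=> z z' /set_mem Az /set_mem Az' /ffunP E.
  have E' i : icol z i = icol z' i /\ irow z i = irow z' i.
    have := E i; rewrite !ffunE => -[e1 e2 e3 e4].
    have [+ +] := Az i; have [+ +] := Az' i; rewrite /colv /rowv !rmxE => r' c' r0 c0.
    by split; apply: enc_inj => //; congr (_, _).
  by apply: colv_rowv_inj => i; rewrite /colv /rowv !rmxE;
    case: (E' i) => [E1 E2]; congr _%:~R.
rewrite -(eq_finite_set (inj_card_eq code_inj)); exact: finite_finset.
Qed.

End coset_geometry.

(** * The equivariant continuous map from the boundary to flags *)

Section boundary_frame.
Variable R : realType.
Local Notation H := SL2_in_SL3.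
Local Notation Z := (left_cosets H).
Local Notation act := (coset_action H).
Implicit Types (g : SL 3) (z : Z) (w : beta Z).

Definition vlim w i : R := ulim (fun z => normalize (colv R z) i) w.
Definition plim w i : R := ulim (fun z => normalize (rowv R z) i) w.

Lemma bounded_colv i : bounded_fct (fun z => normalize (colv R z) i).
Proof. by exists 1 => z; exact: normalize_le1. Qed.

Lemma bounded_rowv i : bounded_fct (fun z => normalize (rowv R z) i).
Proof. by exists 1 => z; exact: normalize_le1. Qed.

Let nrm_colv_gt0 z : 0 < nrm (colv R z).
Proof. exact: lt_le_trans (nrm_colv_ge1 R z). Qed.

Let nrm_rowv_gt0 z : 0 < nrm (rowv R z).
Proof. exact: lt_le_trans (nrm_rowv_ge1 R z). Qed.

(** The scalar is the limit of [|g v| / |v|], a ratio bounded by [entry_norm]. *)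
Lemma vlim_act g w : exists r, forall i,
  \sum_j rmx R g i j * vlim w j = r * vlim (beta_map (act g) w) i.
Proof.
pose r z := nrm (colv R (act g z)) / nrm (colv R z).
have rb : bounded_fct r.
  exists (entry_norm (rmx R g)) => z; rewrite ger0_norm ?divr_ge0 ?nrm_ge0//.
  by rewrite ler_pdivrMr//; apply: nrm_mulmx => i; exact: colv_act.
exists (ulim r w) => i.
transitivity (ulim (fun z => r z * normalize (colv R (act g z)) i) w); last first.
  by rewrite ulimM//; exists 1 => z; exact: normalize_le1.
transitivity (ulim (fun z => \sum_j rmx R g i j * normalize (colv R z) j) w).
  rewrite ulim_sum => [|j].
    apply: eq_bigr => j _; rewrite ulimM ?ulim_cst//.
      exact: bounded_fct_cst.
    exact: bounded_colv.
  by apply: bounded_fctM; [exact: bounded_fct_cst|exact: bounded_colv].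
apply: eq_ulim => z; rewrite /normalize colv_act mulr_suml /r.
rewrite mulr_sumr; apply: eq_bigr => j _.
by field; rewrite !gt_eqF.
Qed.

(** Here the ratio of lengths is reversed, since [rowv_act] expresses the old row through the new
    one. *)
Lemma plim_act g w : exists s, forall j,
  \sum_i plim (beta_map (act g) w) i * rmx R g i j = s * plim w j.
Proof.
pose r z := nrm (rowv R z) / nrm (rowv R (act g z)).
have rb : bounded_fct r.
  exists (entry_norm (rmx R g)^T) => z; rewrite ger0_norm ?divr_ge0 ?nrm_ge0//.
  rewrite ler_pdivrMr//; apply: nrm_mulmx => i; rewrite (rowv_act R g).
  by apply: eq_bigr => j _; rewrite [in RHS]mxE mulrC.
exists (ulim r w) => j.
transitivity (ulim (fun z => r z * normalize (rowv R z) j) w); last first.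
  by rewrite ulimM//; exact: bounded_rowv.
have b1 i : bounded_fct (fun z => normalize (rowv R (act g z)) i).
  by exists 1 => z; exact: normalize_le1.
transitivity (ulim (fun z => \sum_i normalize (rowv R (act g z)) i * rmx R g i j) w).
  rewrite ulim_sum => [|i].
    by apply: eq_bigr => i _; rewrite ulimM ?ulim_cst//; exact: bounded_fct_cst.
  by apply: bounded_fctM => //; exact: bounded_fct_cst.
apply: eq_ulim => z; rewrite /normalize (rowv_act R g z j) mulr_suml /r.
rewrite mulr_sumr; apply: eq_bigr => i _.
by field; rewrite !gt_eqF.
Qed.

Lemma ulim_dot w (u v : Z -> 'I_3 -> R) :
  (forall i, bounded_fct (u ^~ i)) -> (forall i, bounded_fct (v ^~ i)) ->
  dot (fun i => ulim (u ^~ i) w) (fun i => ulim (v ^~ i) w) =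
  ulim (fun z => dot (u z) (v z)) w.
Proof.
move=> ub vb; rewrite /dot ulim_sum => [|i]; last exact: bounded_fctM.
by apply: eq_bigr => i _; rewrite ulimM.
Qed.

Lemma vlim_unit w : dot (vlim w) (vlim w) = 1.
Proof.
rewrite ulim_dot; [|exact: bounded_colv|exact: bounded_colv].
rewrite -[RHS](ulim_cst 1 w); apply: eq_ulim => z.
by rewrite dot_normalize_id// gt_eqF.
Qed.

Lemma plim_unit w : dot (plim w) (plim w) = 1.
Proof.
rewrite ulim_dot; [|exact: bounded_rowv|exact: bounded_rowv].
rewrite -[RHS](ulim_cst 1 w); apply: eq_ulim => z.
by rewrite dot_normalize_id// gt_eqF.
Qed.

(* [rowv z] pairs to 1 with [colv z], and only finitely many cosets have both
   vectors of bounded length, so the normalized vectors become orthogonal. *)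
Lemma plim_vlim_orthogonal w : beta_boundary w -> dot (plim w) (vlim w) = 0.
Proof.
move=> wfree; rewrite ulim_dot; [|exact: bounded_rowv|exact: bounded_colv].
set f := fun z => _.
have fE z : f z = (nrm (rowv R z))^-1 * (nrm (colv R z))^-1.
  by rewrite /f dot_normalize dot_rowv_colv mul1r.
have nV (x : R) : 1 <= x -> 0 <= x^-1 <= 1.
  by move=> x1; rewrite invr_ge0 invf_le1 ?(lt_le_trans _ x1)// x1 (le_trans _ x1).
have f01 z : 0 <= f z.
  by rewrite fE mulr_ge0// invr_ge0 nrm_ge0.
have fb : bounded_fct f.
  exists 1 => z; rewrite ger0_norm// fE -[leRHS]mulr1.
  have /andP[r0 r1] := nV _ (nrm_rowv_ge1 R z).
  by have /andP[c0 c1] := nV _ (nrm_colv_ge1 R z); exact: ler_pM.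
apply/eqP; rewrite -normr_le0 -[ulim _ _]subr0; apply/ler_addgt0Pr => e e0.
rewrite add0r; apply: ulim_near => //; apply: free_ultra_cofinite => //.
apply: (sub_finite_set _ (finite_bounded_cosets e^-1)) => z /= /negP.
rewrite subr0 ger0_norm// -ltNge fE => ef i.
(* Both lengths are at least 1, so a product of inverses above [e] forces each length below
   [e^-1]. *)
have bnd (x y : R) : 1 <= x -> 1 <= y -> e < x^-1 * y^-1 -> x <= e^-1.
  move=> x1 y1 exy; have x0 : 0 < x by exact: lt_le_trans x1.
  have y0 : 0 < y by exact: lt_le_trans y1.
  rewrite -[x]invrK lef_pV2 ?posrE ?invr_gt0//; apply: le_trans (ltW exy) _.
  by rewrite ler_piMr ?invr_ge0 ?(ltW x0)// invf_le1.
split.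
  apply: le_trans (entry_le_nrm _ i) _.
  by rewrite mulrC in ef; exact: (bnd _ _ (nrm_colv_ge1 R z) (nrm_rowv_ge1 R z)).
apply: le_trans (entry_le_nrm _ i) _.
exact: (bnd _ _ (nrm_rowv_ge1 R z) (nrm_colv_ge1 R z)).
Qed.

Definition boundary_frame (w : @beta_boundary Z) : frame R :=
  Frame (flag_mx_orthogonal (vlim_unit (\val w)) (plim_unit (\val w))
    (plim_vlim_orthogonal (set_mem (valP w)))).

Lemma boundary_frame_upper g (w : @beta_boundary Z) :
  upper ((boundary_frame (boundary_action act g w))^T *m rmx R g *m
    boundary_frame w).
Proof.
have [v0 _ v2] := flag_mxE (vlim (\val w)) (plim (\val w)).
have [v'0 _ v'2] := flag_mxE (vlim (beta_map (act g) (\val w)))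
  (plim (beta_map (act g) (\val w))).
have [r Hr] := vlim_act g (\val w); have [s Hs] := plim_act g (\val w).
apply: (upper_frames (r := r) (s := s)) => [a|b] /=.
  by rewrite v'0 -Hr; apply: eq_bigr => b _; rewrite v0.
by rewrite v2 -Hs; apply: eq_bigr => a _; rewrite v'2.
Qed.

(** The second half is the first one for [g^-1] at the translated point. *)
Lemma boundary_frame_maps_flag g (w : @beta_boundary Z) :
  maps_flag g (boundary_frame w) (boundary_frame (boundary_action act g w)).
Proof.
split; first exact: boundary_frame_upper.
have := boundary_frame_upper g^-1%g (boundary_action act g w).
by rewrite -[boundary_action _ _ (boundary_action _ _ _)]actM mulVg act1.
Qed.

Lemma boundary_frame_continuous i j :
  continuous (fun w : @beta_boundary Z => (boundary_frame w : 'M[R]_3) i j).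
Proof.
have cval := @initial_continuous (@beta_boundary Z) (beta Z) set_val.
have cv l : continuous (fun w : @beta_boundary Z => vlim (\val w) l).
  move=> w; apply: (continuous_comp (cval w)).
  by apply: ulim_continuous; exact: bounded_colv.
have cp l : continuous (fun w : @beta_boundary Z => plim (\val w) l).
  move=> w; apply: (continuous_comp (cval w)).
  by apply: ulim_continuous; exact: bounded_rowv.
have cpv a b : continuous (fun w : @beta_boundary Z =>
    plim (\val w) a * vlim (\val w) b - plim (\val w) b * vlim (\val w) a).
  by move=> w; exact: (cvgB (cvgM (cp a w) (cv b w)) (cvgM (cp b w) (cv a w))).
have E (w : @beta_boundary Z) := flag_mxE (vlim (\val w)) (plim (\val w)).
move: j; apply: forall3.
- have -> : (fun w : @beta_boundary Z => (boundary_frame w : 'M[R]_3) i 0) =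
      (fun w : @beta_boundary Z => vlim (\val w) i) by apply/funext => w; case: (E w).
  exact: cv.
- have -> : (fun w : @beta_boundary Z => (boundary_frame w : 'M[R]_3) i 1) =
      (fun w : @beta_boundary Z => cross (plim (\val w)) (vlim (\val w)) i).
    by apply/funext => w; case: (E w).
  by move: i; apply: forall3; [exact: cpv|exact: cpv|exact: cpv].
- have -> : (fun w : @beta_boundary Z => (boundary_frame w : 'M[R]_3) i 2%:R) =
      (fun w : @beta_boundary Z => plim (\val w) i) by apply/funext => w; case: (E w).
  exact: cp.
Qed.

End boundary_frame.

Theorem theorem1p3 (R : realType) :
  amenable R (boundary_action (coset_action SL2_in_SL3)).
Proof.
have e0 n : 0 < (n.+1%:R^-1 : R) by rewrite invr_gt0.
(* The [n]-th mean has error at most [1 / n.+1] for those [g] for which [g] and [g^-1] have entry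
   norm at most [n]; any fixed [g] is eventually among them. *)
pose mu0 n := projT1 (cid (frame_mean_exists (ler0n R n) (e0 n))).
have Hmu n := projT2 (cid (frame_mean_exists (ler0n R n) (e0 n))).
exists _, nat, (fun n w => mu0 n (boundary_frame R w)); split.
- by split; [exists 0%N|move=> k l; exists (maxn k l); rewrite !leEnat leq_maxl leq_maxr].
- move=> n; apply: continuous_prob => h w U /nbhs_ballP[eta /= eta0 etaU].
  have [_ /(_ (eta / 2))] := Hmu n; rewrite divr_gt0// => /(_ isT)[d d0 Hd].
  have near_entry i j : nbhs w [set w' |
      `|(boundary_frame R w' : 'M[R]_3) i j - (boundary_frame R w : 'M[R]_3) i j| <= d].
    have := @boundary_frame_continuous R i j w _ (nbhsx_ballx _ d d0).
    apply: (@filterS _ (nbhs w) (nbhs_filter w)) => w' /=.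
    by rewrite /ball /= distrC => /ltW.
  have : nbhs w [set w' | forall i j,
      `|(boundary_frame R w' : 'M[R]_3) i j - (boundary_frame R w : 'M[R]_3) i j| <= d].
    apply: (@filter_forall _ 'I_3 _ (nbhs w) (nbhs_filter w)) => i.
    apply: (@filter_forall _ 'I_3 _ (nbhs w) (nbhs_filter w)) => j.
    exact: near_entry.
  apply: (@filterS _ (nbhs w) (nbhs_filter w)) => w' ww'; apply: etaU.
  rewrite /ball /= distrC.
  by apply: le_lt_trans (Hd _ _ ww' h) _; rewrite ltr_pdivrMr// ltr_pMr// ltr1n.
- move=> g; pose c := entry_norm (rmx R g) + entry_norm (rmx R g^-1%g).
  have n0 A : 0 <= entry_norm (A : 'M[R]_3) by do 2!(apply: sumr_ge0 => ? _).
  apply: (@squeeze_cvge _ _ _ _ (fun=> 0%E) _ (fun n => (n.+1%:R^-1)%:E)).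
  + exists (Num.truncn c).+1 => // n /= cn; apply/andP; split.
      (* The defect is nonnegative because 0 was adjoined to the set under the supremum. *)
      by apply: ereal_sup_ubound; left.
    have cn' : c <= n%:R.
      by apply: le_trans (ltW (truncnS_gt c)) _; rewrite ler_nat.
    apply: ge_ereal_sup => _ [->|[w _ <-]]; first by rewrite lee_fin ltW.
    apply: esum_le_seq; apply: (Hmu n).1.
    * exact: boundary_frame_maps_flag.
    * by apply: le_trans cn'; rewrite lerDl.
    * by apply: le_trans cn'; rewrite lerDr.
  + exact: cvg_cst.
  + apply: cvg_EFin; first exact: nearW.
    exact: cvg_harmonic.
Qed.
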